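(* Let $\eta\in[0,1)$, and let $x\in\mathbb{R}^d$ and $y\in\mathbb{R}^n$ be jointly Gaussian random vectors such that the conditional covariance matrix of $y$ given $x$ is positive definite. Consider the optimization problem $$(\mathrm{MVE}):\quad \min_{\mathcal{E}(\mu(\cdot),C(\cdot))}\ \mathbb{E}\left[\mathrm{Vol}_{\mathcal{E}}(x)\right]\quad\text{subject to}\quad \Pr\left[y\in\mathcal{E}(\mu(x),C(x))\right]\ge\eta,$$ where the minimum is over functions $\mu(\cdot)$ of $x$ with values in $\mathbb{R}^n$ (centers) and functions $C(\cdot)$ of $x$ with values in the symmetric positive definite $n\times n$ real matrices (shapes). Then the optimal solution to (MVE) is $$\mu(x)=\mathbb{E}[y\mid x],\qquad C(x)=\kappa(x)\cdot\mathbb{E}\left[(y-\mu(x))(y-\mu(x))^T\right],$$ where $\kappa(x)>0$ is a scalar scaling factor that satisfies the coverage constraint of (MVE), i.e. $\Pr[y\in\mathcal{E}(\mu(x),C(x))]\ge\eta$.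
   Context: Here $x$ is a features vector and $y$ a labels vector, and $\eta$ is a prescribed coverage probability. For a center $\mu(x)\in\mathbb{R}^n$ and a shape matrix $C(x)\succ 0$ in $\mathbb{R}^{n\times n}$, the uncertainty ellipsoid on $y$ given $x$ is $\mathcal{E}(\mu(x),C(x))=\{y\in\mathbb{R}^n:(y-\mu(x))^TC^{-1}(x)(y-\mu(x))\le 1\}$. Its volume is $\mathrm{Vol}_{\mathcal{E}}(x)=c_n\det(C(x))^{1/2}$, where $c_n$ is the volume of the unit ball in $\mathbb{R}^n$. Both $x$ and $y$ are random (Bayesian setting): the probability in the coverage constraint is over the joint distribution of $(x,y)$, the expectation in the objective is over $x$, and the expectation $\mathbb{E}[(y-\mu(x))(y-\mu(x))^T]$ is over the joint distribution of $(x,y)$; in the jointly Gaussian case it equals the conditional covariance of $y$ given $x$, which does not depend on $x$.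
   Formalization: Existence of the optimal solution is claimed only for η > 0: at η = 0 (n ≥ 1) the infimum 0 of (MVE) is not attained; there it is shown that solutions of the stated form dominate every feasible one. κ is some suitable factor satisfying the coverage constraint, not every such factor. *)

(* Defs.v *)
From HB Require Import structures.
From mathcomp Require Import all_boot all_order all_algebra.
From mathcomp Require Import all_classical all_reals all_analysis.

Set Implicit Arguments.
Unset Strict Implicit.
Unset Printing Implicit Defensive.

Import Order.TTheory GRing.Theory Num.Theory.

Local Open Scope classical_set_scope.
Local Open Scope ring_scope.

Definition measure_matrix_display : measure_display -> measure_display.
Proof. exact. Qed.

(* The sigma-algebra on matrices (hence on column vectors) is the one generated
   by the entries; for real entries it is the Borel sigma-algebra. *)
Section measurable_matrix.
Context d (T : measurableType d) (m n : nat).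

Definition entry_preimages : set (set 'M[T]_(m, n)) :=
  \bigcup_(ij in [set: 'I_m * 'I_n])
    preimage_set_system setT (fun A : 'M[T]_(m, n) => A ij.1 ij.2) measurable.

Definition matrix_measurable : set (set 'M[T]_(m, n)) := <<s entry_preimages >>.

Let matrix_set0 : matrix_measurable set0.
Proof. exact: sigma_algebra0. Qed.

Let matrix_setC A : matrix_measurable A -> matrix_measurable (~` A).
Proof. exact: sigma_algebraC. Qed.

Let matrix_bigcup (F : (set 'M[T]_(m, n))^nat) :
  (forall i, matrix_measurable (F i)) -> matrix_measurable (\bigcup_i F i).
Proof. exact: sigma_algebra_bigcup. Qed.

HB.instance Definition _ := @isMeasurable.Build (measure_matrix_display d)
  'M[T]_(m, n) matrix_measurable matrix_set0 matrix_setC matrix_bigcup.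

End measurable_matrix.

Section ellipsoids.
Context {R : realType}.

(* Lebesgue measure on R^n as the n-fold product measure: the measure of A is
   the integral over the first coordinate of the measures of the sections. *)
Fixpoint lebesgue_volume (n : nat) : set 'cV[R]_n -> \bar R :=
  match n return set 'cV[R]_n -> \bar R with
  | 0 => fun A => (\1_A (0 : 'cV[R]_0))%:E
  | k.+1 => fun A =>
      (\int[lebesgue_measure]_t
         lebesgue_volume [set v : 'cV[R]_k | A (col_mx (t%:M : 'cV[R]_1) v)])%E
  end.

Definition unit_ball_volume (n : nat) : \bar R :=
  lebesgue_volume [set v : 'cV[R]_n | (v^T *m v) 0 0 <= 1].

Definition posdefmx (n : nat) (A : 'M[R]_n) : Prop :=
  A^T = A /\ forall v : 'cV[R]_n, v != 0 -> 0 < (v^T *m A *m v) 0 0.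

Definition ellipsoid (n : nat) (mu : 'cV[R]_n) (C : 'M[R]_n) : set 'cV[R]_n :=
  [set y | ((y - mu)^T *m invmx C *m (y - mu)) 0 0 <= 1].

Definition ellipsoid_volume (n : nat) (C : 'M[R]_n) : \bar R :=
  (unit_ball_volume n * (Num.sqrt (\det C))%:E)%E.

End ellipsoids.

Section random_vectors.
Context {disp : measure_display} {Omega : measurableType disp} {R : realType}.
Variable P : probability Omega R.

(* Independent N(0,1) coordinates: taking some [B i := setT] gives the product
   rule for every subfamily. *)
Definition standard_gaussian (k : nat) (Z : {RV P >-> 'cV[R]_k}) : Prop :=
  forall B : 'I_k -> set R, (forall i, measurable (B i)) ->
    P [set w | forall i, B i (Z w i 0)]
    = (\prod_(i < k) normal_prob 0 1 (B i))%E.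

(* Degenerate laws are allowed, as A may have any rank. *)
Definition gaussian_vector (q : nat) (X : Omega -> 'cV[R]_q) : Prop :=
  exists (k : nat) (A : 'M[R]_(q, k)) (b : 'cV[R]_q)
    (Z : {RV P >-> 'cV[R]_k}),
    standard_gaussian Z /\ {ae P, forall w, X w = A *m Z w + b}.

Definition jointly_gaussian (d n : nat)
    (x : {RV P >-> 'cV[R]_d}) (y : {RV P >-> 'cV[R]_n}) : Prop :=
  gaussian_vector (fun w => col_mx (x w) (y w)).

(* [g] is a version of u |-> E[f | x = u]; it is determined up to a set that is
   null for the law of [x]. *)
Definition is_cond_expectation (d : nat) (x : {RV P >-> 'cV[R]_d})
    (f : Omega -> R) (g : 'cV[R]_d -> R) : Prop :=
  [/\ P.-integrable setT (EFin \o f),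
      measurable_fun setT g,
      P.-integrable setT (EFin \o (g \o x))
    & forall B : set 'cV[R]_d, measurable B ->
        (\int[P]_(w in x @^-1` B) (g (x w))%:E
         = \int[P]_(w in x @^-1` B) (f w)%:E)%E].

Definition is_cond_mean (d n : nat)
    (x : {RV P >-> 'cV[R]_d}) (y : {RV P >-> 'cV[R]_n})
    (m : 'cV[R]_d -> 'cV[R]_n) : Prop :=
  forall i, is_cond_expectation x (fun w => y w i 0) (fun u => m u i 0).

Definition outer_error (d n : nat)
    (x : {RV P >-> 'cV[R]_d}) (y : {RV P >-> 'cV[R]_n})
    (m : 'cV[R]_d -> 'cV[R]_n) (w : Omega) : 'M[R]_n :=
  (y w - m (x w)) *m (y w - m (x w))^T.

(* [m] is meant to be a version of E[y | x]. *)
Definition is_cond_covariance (d n : nat)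
    (x : {RV P >-> 'cV[R]_d}) (y : {RV P >-> 'cV[R]_n})
    (m : 'cV[R]_d -> 'cV[R]_n) (S : 'cV[R]_d -> 'M[R]_n) : Prop :=
  forall i j, is_cond_expectation x
    (fun w => outer_error x y m w i j) (fun u => S u i j).

Definition error_covariance (d n : nat)
    (x : {RV P >-> 'cV[R]_d}) (y : {RV P >-> 'cV[R]_n})
    (m : 'cV[R]_d -> 'cV[R]_n) : 'M[R]_n :=
  \matrix_(i, j) fine 'E_P[fun w => outer_error x y m w i j].

Definition mve_objective (d n : nat) (x : {RV P >-> 'cV[R]_d})
    (C : 'cV[R]_d -> 'M[R]_n) : \bar R :=
  (\int[P]_w ellipsoid_volume (C (x w)))%E.

Definition mve_feasible (d n : nat)
    (x : {RV P >-> 'cV[R]_d}) (y : {RV P >-> 'cV[R]_n}) (eta : R)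
    (mu : 'cV[R]_d -> 'cV[R]_n) (C : 'cV[R]_d -> 'M[R]_n) : Prop :=
  [/\ measurable_fun setT mu,
      measurable_fun setT C,
      forall u, posdefmx (C u)
    & (eta%:E <= P [set w | ellipsoid (mu (x w)) (C (x w)) (y w)])%E].

Definition mve_optimal (d n : nat)
    (x : {RV P >-> 'cV[R]_d}) (y : {RV P >-> 'cV[R]_n}) (eta : R)
    (mu : 'cV[R]_d -> 'cV[R]_n) (C : 'cV[R]_d -> 'M[R]_n) : Prop :=
  mve_feasible x y eta mu C /\
  forall mu' C', mve_feasible x y eta mu' C' ->
    (mve_objective x C <= mve_objective x C')%E.

End random_vectors.

(* Main.v *)
(** Gaussian regression writes [y = m x + L w] with [w] standard Gaussian and
    independent of [x].  Given [x = u], a candidate ellipsoid thus becomes an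
    ellipsoid [whitened u] in the coordinate [w], of volume proportional to the
    original one, and the candidate (m, kappa Sigma) becomes a centred ball [B].
    Let [t] be the value of the standard Gaussian density on the boundary of [B].
    Comparing integrands pointwise, [B] maximises [gauss E - t * vol E] over all
    measurable [E] (Neyman-Pearson), and no other ellipsoid attains the maximum.
    Choose the radius of [B] by [gauss B = eta] when [0 < eta]: integrating the
    comparison over [x] shows that this constant radius is optimal and that every
    optimum agrees with it almost everywhere.  For [eta = 0] and [0 < n] arbitrarily
    small balls are feasible, so that there is no optimum at all.

    Rotation invariance of the Gaussian law comes from that of Lebesgue measure,
    which is proved by double counting, without change of variables; volumes of
    ellipsoids come from Cholesky factors, whose action is triangular and hence
    reduces to one-dimensional affine substitutions. *)
Require Import Defs.
From HB Require Import structures.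
From mathcomp Require Import all_boot all_order all_algebra.
From mathcomp Require Import all_classical all_reals all_analysis.
From mathcomp Require Import measurable_realfun perm ring lra.

Set Implicit Arguments.
Unset Strict Implicit.
Unset Printing Implicit Defensive.

Import Order.TTheory GRing.Theory Num.Theory.

Local Open Scope classical_set_scope.
Local Open Scope ring_scope.

(* The measure structure of [pushforward mu phi] takes a proof of the measurability
   of [phi], which inference cannot supply. *)
Local Notation image_measure :=
  measure_function_pushforward__canonical__measure_function_Measure.

(** The coverage constraint binds only on average over [x], so a competitor may trade coverage
    between values of [x], and a comparison at equal coverage for each [x] would not suffice. The
    multiplier [t] is the same for every [x]; this is what lets a pointwise inequality integrate to
    one between total coverage and expected volume.

    The hypotheses give access to the laws only indirectly: the Gaussian law through probabilities
    of boxes, [m] and [S] through integrals over events [x \in B]. Boxes form a generating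
    pi-system, which fixes the law of the underlying Gaussian vector; [m] is identified with an
    affine regression function by uniqueness of conditional expectations.

    The law of [x] may be degenerate, so the regression coefficient is built from an orthonormal
    basis of a row space instead of an inverse covariance. Positive definiteness of the conditional
    covariance enters through its mean, the error covariance; it makes [L] invertible. That
    covariance is computed only up to a positive scalar, which [kappa] absorbs. *)

Section image_measure.
Context d1 d2 (X : measurableType d1) (Y : measurableType d2) (R : realType).
Variables (mu : {measure set X -> \bar R}) (nu : {measure set Y -> \bar R}).
Variable phi : X -> Y.
Hypothesis mphi : measurable_fun setT phi.
Hypothesis nuE : forall A, measurable A -> nu A = mu (phi @^-1` A).

Lemma ge0_integral_image (f : Y -> \bar R) :
  measurable_fun setT f -> (forall y, 0 <= f y)%E ->
  (\int[nu]_y f y = \int[mu]_x f (phi x))%E.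
Proof.
move=> mf f0; transitivity (\int[pushforward mu phi]_y f y)%E.
  by apply: (eq_measure_integral (pushforward mu phi)) => A mA _; exact: nuE.
by rewrite ge0_integral_pushforward// => y _; exact: f0.
Qed.

Lemma integral_image (f : Y -> \bar R) :
  measurable_fun setT f -> mu.-integrable setT (f \o phi) ->
  (\int[nu]_y f y = \int[mu]_x f (phi x))%E.
Proof.
move=> mf intf; transitivity (\int[pushforward mu phi]_y f y)%E.
  by apply: (eq_measure_integral (pushforward mu phi)) => A mA _; exact: nuE.
by rewrite integral_pushforward.
Qed.

End image_measure.

(** * Measurability of matrix-valued functions *)

Section matrix_measurability.
Context {R : realType}.

Lemma measurable_mx_entry m n (i : 'I_m) (j : 'I_n) :
  measurable_fun setT (fun A : 'M[R]_(m, n) => A i j).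
Proof.
move=> _ B mB; apply: sub_sigma_algebra; exists (i, j) => //.
by exists B => //=; rewrite setTI.
Qed.

Lemma measurable_mxP d (T : measurableType d) m n (f : T -> 'M[R]_(m, n)) :
  measurable_fun setT f <->
  forall i j, measurable_fun setT (fun t => f t i j).
Proof.
split=> [mf i j|mf].
  by apply: (measurableT_comp (measurable_mx_entry i j)).
apply: (@measurability _ _ _ _ _ _ (@entry_preimages _ R m n) erefl).
move=> _ [_ [[i j] _ [B mB <-]] <-].
by have := mf i j measurableT B mB; rewrite !setTI.
Qed.

End matrix_measurability.

Section matrix_operations.
Context {R : realType} {d} {T : measurableType d}.

Lemma measurable_mulmx m n p (f : T -> 'M[R]_(m, n)) (g : T -> 'M[R]_(n, p)) :
  measurable_fun setT f -> measurable_fun setT g ->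
  measurable_fun setT (fun t => f t *m g t).
Proof.
move=> /measurable_mxP mf /measurable_mxP mg; apply/measurable_mxP => i j.
under eq_fun do rewrite mxE.
by apply: measurable_sum => k; apply: measurable_funM.
Qed.

Lemma measurable_addmx m n (f g : T -> 'M[R]_(m, n)) :
  measurable_fun setT f -> measurable_fun setT g ->
  measurable_fun setT (fun t => f t + g t).
Proof.
move=> /measurable_mxP mf /measurable_mxP mg; apply/measurable_mxP => i j.
by under eq_fun do rewrite mxE; apply: measurable_funD.
Qed.

Lemma measurable_oppmx m n (f : T -> 'M[R]_(m, n)) :
  measurable_fun setT f -> measurable_fun setT (fun t => - f t).
Proof.
move=> /measurable_mxP mf; apply/measurable_mxP => i j.
by under eq_fun do rewrite mxE; apply: measurable_funN.
Qed.

Lemma measurable_submx m n (f g : T -> 'M[R]_(m, n)) :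
  measurable_fun setT f -> measurable_fun setT g ->
  measurable_fun setT (fun t => f t - g t).
Proof. by move=> mf mg; apply/measurable_addmx => //; exact: measurable_oppmx. Qed.

Lemma measurable_trmx m n (f : T -> 'M[R]_(m, n)) :
  measurable_fun setT f -> measurable_fun setT (fun t => (f t)^T).
Proof.
move=> /measurable_mxP mf; apply/measurable_mxP => i j.
by under eq_fun do rewrite mxE; exact: mf.
Qed.

Lemma measurable_col_mx m1 m2 n (f : T -> 'M[R]_(m1, n)) (g : T -> 'M[R]_(m2, n)) :
  measurable_fun setT f -> measurable_fun setT g ->
  measurable_fun setT (fun t => col_mx (f t) (g t)).
Proof.
move=> /measurable_mxP mf /measurable_mxP mg; apply/measurable_mxP => i j.
under eq_fun do rewrite mxE.
by case: (fintype.split i) => k; [exact: mf|exact: mg].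
Qed.

Lemma measurable_scalar_mx n (f : T -> R) :
  measurable_fun setT f -> measurable_fun setT (fun t => (f t)%:M : 'M[R]_n).
Proof.
move=> mf; apply/measurable_mxP => i j; under eq_fun do rewrite mxE.
case: (i == j) => /=; first by under eq_fun do rewrite mulr1n.
by under eq_fun do rewrite mulr0n; exact: measurable_cst.
Qed.

Lemma measurable_det n (f : T -> 'M[R]_n) :
  measurable_fun setT f -> measurable_fun setT (fun t => \det (f t)).
Proof.
move=> /measurable_mxP mf; apply: measurable_sum => s.
by apply: measurable_funM => //; apply: measurable_prod.
Qed.

Lemma measurable_adjugate n (f : T -> 'M[R]_n) :
  measurable_fun setT f -> measurable_fun setT (fun t => \adj (f t)).
Proof.
move=> /measurable_mxP mf; apply/measurable_mxP => i j.
under eq_fun do rewrite mxE; apply: measurable_funM => //.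
by apply: measurable_det; apply/measurable_mxP => k l;
  under eq_fun do rewrite !mxE; exact: mf.
Qed.

End matrix_operations.

(** * Lebesgue volume as a measure *)

Section lebesgue_volume_measure.
Context {R : realType}.

Let consv k (p : R * 'cV[R]_k) : 'cV[R]_k.+1 := col_mx (p.1%:M : 'cV[R]_1) p.2.

Let measurable_consv k : measurable_fun setT (@consv k).
Proof.
rewrite /consv.
have mf : measurable_fun setT (fun p : R * 'cV[R]_k => p.1%:M : 'M[R]_1).
  by apply: measurable_scalar_mx; exact: measurable_fst.
exact: (@measurable_col_mx R _ _ 1 k 1 _ _ mf measurable_snd).
Qed.

Let box_consv k (A : set 'cV[R]_k.+1) t :
  [set v : 'cV[R]_k | A (col_mx (t%:M : 'cV[R]_1) v)] = xsection (@consv k @^-1` A) t.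
Proof. by apply/seteqP; split=> v; rewrite /xsection /= inE. Qed.

(** The recursion yields bare set functions, while a product measure needs a sigma-finite measure in
    the remaining coordinates; the induction therefore carries a packaged measure. In the successor
    case it is the image of a product measure under prepending a coordinate. *)
Let lebesgue_volume_ex n : exists m : {sigma_finite_measure set 'cV[R]_n -> \bar R},
  @lebesgue_volume R n = m.
Proof.
elim: n => [|k [m mE]].
  by exists (dirac (0 : 'cV[R]_0)); apply/funext => A /=; rewrite diracE indicE.
pose nu := image_measure
  (lebesgue_measure \x m)%E (@measurable_consv k).
have nuE : @lebesgue_volume R k.+1 = nu.
  apply/funext => A.
  rewrite /= /pushforward /= /product_measure1; apply: eq_integral => t _.
  by rewrite mE /= box_consv.
have sf : sigma_finite setT nu.
  have /sigma_finiteP [F [TF ndF Foo]] := sigma_finiteT (@lebesgue_measure R).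
  have /sigma_finiteP [G [TG ndG Goo]] := sigma_finiteT m.
  pose S i := [set v : 'cV[R]_k.+1 | F i (usubmx (v : 'cV_(1 + k)) 0 0)] `&`
              [set v : 'cV[R]_k.+1 | G i (dsubmx (v : 'cV_(1 + k)))].
  have SE i : @consv k @^-1` S i = F i `*` G i.
    apply/seteqP; split=> -[t v];
      by rewrite /S /consv /= (@col_mxKu _ 1) (@col_mxKd _ 1) !mxE eqxx mulr1n.
  exists S.
    apply/seteqP; split=> // v _.
    have [i _ Fi] : (\bigcup_i F i) (usubmx (v : 'cV_(1 + k)) 0 0) by rewrite -TF.
    have [j _ Gj] : (\bigcup_i G i) (dsubmx (v : 'cV_(1 + k))) by rewrite -TG.
    (* Both exhausting sequences increase, so the larger index serves for both factors. *)
    exists (maxn i j) => //; split => /=.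
      by move: Fi; exact/subsetPset/ndF/leq_maxl.
    by move: Gj; exact/subsetPset/ndG/leq_maxr.
  move=> i; have [mF ltF] := Foo i; have [mG ltG] := Goo i; split.
    apply: measurableI.
      rewrite -[X in measurable X]setTI.
      apply: (_ : measurable_fun setT
        (fun v : 'cV[R]_k.+1 => usubmx (v : 'cV_(1 + k)) 0 0)) => //.
      by under eq_fun do rewrite mxE; exact: measurable_mx_entry.
    rewrite -[X in measurable X]setTI.
    apply: (_ : measurable_fun setT
      (fun v : 'cV[R]_k.+1 => dsubmx (v : 'cV_(1 + k)))) => //.
    apply/measurable_mxP => a b; under eq_fun do rewrite mxE.
    exact: measurable_mx_entry.
  rewrite /= /pushforward SE product_measure1E// lte_mul_pinfty//.
  by rewrite ge0_fin_numE.
pose M := Measure_isSigmaFinite.Build _ _ _ nu sf.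
pose m' : {sigma_finite_measure set 'cV[R]_k.+1 -> \bar R} :=
  HB.pack (Measure.sort nu) M.
by exists m'.
Qed.

Let lebesgue_volume0 n : @lebesgue_volume R n set0 = 0%E.
Proof. by have [m ->] := lebesgue_volume_ex n; rewrite measure0. Qed.

Let lebesgue_volume_ge0 n A : (0 <= @lebesgue_volume R n A)%E.
Proof. by have [m ->] := lebesgue_volume_ex n. Qed.

Let lebesgue_volume_sigma_additive n : semi_sigma_additive (@lebesgue_volume R n).
Proof.
by have [m ->] := lebesgue_volume_ex n; exact: measure_semi_sigma_additive.
Qed.

HB.instance Definition _ n := isMeasure.Build _ _ _ (@lebesgue_volume R n)
  (lebesgue_volume0 n) (@lebesgue_volume_ge0 n) (@lebesgue_volume_sigma_additive n).

Let lebesgue_volume_sigma_finite n : sigma_finite setT (@lebesgue_volume R n).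
Proof. by have [m ->] := lebesgue_volume_ex n; exact: sigma_finiteT. Qed.

HB.instance Definition _ n := Measure_isSigmaFinite.Build _ _ _
  (@lebesgue_volume R n) (lebesgue_volume_sigma_finite n).

Lemma measurable_lebesgue_volume_section k (A : set 'cV[R]_k.+1) :
  measurable A ->
  measurable_fun setT (fun t : R =>
    lebesgue_volume [set v : 'cV[R]_k | A (col_mx (t%:M : 'cV[R]_1) v)]).
Proof.
move=> mA; under eq_fun do rewrite box_consv.
apply: measurable_fun_xsection.
by rewrite -[X in measurable X]setTI; exact: measurable_consv.
Qed.

Lemma ge0_integral_lebesgue_volumeS k (f : 'cV[R]_k.+1 -> \bar R) :
  measurable_fun setT f -> (forall v, 0 <= f v)%E ->
  (\int[lebesgue_volume (n:=k.+1)]_v f v =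
   \int[lebesgue_measure]_t \int[lebesgue_volume (n:=k)]_v
     f (col_mx (t%:M : 'cV[R]_1) v))%E.
Proof.
move=> mf f0.
rewrite (ge0_integral_image (mu := (lebesgue_measure \x @lebesgue_volume R k)%E)
  (@measurable_consv k))//.
  by rewrite fubini_tonelli1//; exact: (measurableT_comp mf (@measurable_consv k)).
move=> A mA /=; rewrite /product_measure1.
by apply: eq_integral => t _; rewrite box_consv.
Qed.

End lebesgue_volume_measure.

(** * Boxes as a generating pi-system *)

Section boxes.
Context {R : realType}.

Definition box n (B : 'I_n -> set R) : set 'cV[R]_n :=
  [set v | forall i, B i (v i 0)].

Definition boxes n : set (set 'cV[R]_n) :=
  [set box B | B in [set B : 'I_n -> set R | forall i, measurable (B i)]].

Lemma measurable_box n (B : 'I_n -> set R) :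
  (forall i, measurable (B i)) -> measurable (box B).
Proof.
move=> mB.
rewrite (_ : box B = \bigcap_i [set v : 'cV[R]_n | B i (v i 0)]); last first.
  by apply/seteqP; split => [v + i _|v + i]; exact.
apply: fin_bigcap_measurable => // i _.
by rewrite -[X in measurable X]setTI; exact: measurable_mx_entry.
Qed.

Lemma boxT n : box (fun _ : 'I_n => setT) = setT.
Proof. by apply/seteqP. Qed.

Lemma measurable_boxesE n : measurable = <<s @boxes n >>.
Proof.
apply/seteqP; split; last first.
  apply: smallest_sub; first exact: sigma_algebra_measurable.
  by move=> _ [B mB <-]; exact: measurable_box.
apply: smallest_sub; first exact: smallest_sigma_algebra.
move=> _ [[i j] _ [B mB <-]]; apply: sub_sigma_algebra => /=.
exists (fun k => if k == i then B else setT); first by move=> k; case: ifP.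
rewrite setTI; apply/seteqP; split=> v /=; rewrite (ord1 j) /box/=.
  by move=> /(_ i); rewrite eqxx.
by move=> Bv k; case: eqP => // ->.
Qed.

(** Boxes are closed under intersection and generate the sigma-algebra. The whole space is itself a
    box, so for a finite measure the constant exhaustion by [setT] is enough. *)
Lemma box_measure_unique n (m1 m2 : {measure set 'cV[R]_n -> \bar R}) :
  (m1 setT < +oo)%E ->
  (forall B : 'I_n -> set R, (forall i, measurable (B i)) ->
    m1 (box B) = m2 (box B)) ->
  forall A, measurable A -> m1 A = m2 A.
Proof.
move=> m1T m12; apply: (measure_unique (@boxes n) (fun=> setT)) => //.
- exact: measurable_boxesE.
- move=> _ _ [B mB <-] [B' mB' <-]; exists (fun i => B i `&` B' i).
    by move=> i; exact: measurableI.
  by apply/seteqP; split=> v /=; [split=> i; case: (H i)|case=> ? ? i; split].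
- by move=> i; exists (fun=> setT) => //; exact: boxT.
- by rewrite bigcup_const//; exists 0%N.
- by move=> _ [B mB <-]; exact: m12.
Qed.

End boxes.

Section affine_volume.
Context {R : realType}.
Local Notation lambda := lebesgue_measure.

(** The right-hand side is a multiple of an image measure, and Lebesgue measure is determined by the
    lengths of half-open intervals. *)
Lemma lebesgue_measure_affine (l c : R) (A : set R) : 0 < l -> measurable A ->
  lambda A = (l%:E * lambda [set t | A (l * t + c)%R])%E.
Proof.
move=> l0 mA.
have mphi : measurable_fun setT
    (fun t : measurableTypeR R => l * t + c : measurableTypeR R).
  by apply: measurable_funD => //; apply: measurable_funM.
pose nu := mscale (NngNum (ltW l0)) (image_measure lebesgue_measure mphi).
rewrite (@lebesgue_measure_unique R nu)// => _ [[a b] _ <-] /=.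
rewrite /nu /mscale /= /pushforward.
rewrite [X in (_ * lambda X)%E](_ : _ = `](a - c) / l, (b - c) / l]%classic);
  last first.
  apply/seteqP; split => t /=; rewrite !in_itv/= ltr_pdivrMr// ler_pdivlMr//;
    by rewrite ltrBlDr lerBrDr mulrC.
rewrite !lebesgue_measure_itv/= !lte_fin.
rewrite ltr_pM2r ?invr_gt0// ltrD2r; case: ifPn => _; last by rewrite mule0.
rewrite -!EFinD -EFinM; congr EFin.
by field; rewrite gt_eqF.
Qed.

Lemma ge0_integral_affine (l c : R) (f : R -> \bar R) : 0 < l ->
  measurable_fun setT f -> (forall t, 0 <= f t)%E ->
  (\int[lambda]_t f t = l%:E * \int[lambda]_t f (l * t + c)%R)%E.
Proof.
move=> l0 mf f0.
have mphi : measurable_fun setT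
    (fun t : measurableTypeR R => l * t + c : measurableTypeR R).
  by apply: measurable_funD => //; apply: measurable_funM.
pose nu := mscale (NngNum (ltW l0)) lambda.
rewrite (@ge0_integral_image _ _ _ _ _ nu _ _ mphi)//.
  rewrite ge0_integral_mscale//.
  exact: measurableT_comp.
by move=> A mA; exact: lebesgue_measure_affine.
Qed.

End affine_volume.

(** * Linear maps and volume *)

Section volume_scaling.
Context {R : realType}.
Local Notation vol := (@lebesgue_volume R _).

(** Asking for a positive determinant spares the absolute value. The translation [b] belongs to the
    property because the triangular step meets shifts that depend on the first coordinate. *)
Definition volume_scaling n (M : 'M[R]_n) : Prop :=
  0 < \det M /\ forall (A : set 'cV[R]_n) b, measurable A ->
    ((\det M)%:E * vol [set v | A (M *m v + b)%R])%E = vol A.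

Lemma measurable_affine_preimage m n (M : 'M[R]_(m, n)) b (A : set 'cV[R]_m) :
  measurable A -> measurable [set v | A (M *m v + b)].
Proof.
move=> mA; rewrite -[X in measurable X]setTI.
apply: (_ : measurable_fun setT (fun v => M *m v + b)) => //.
by apply: measurable_addmx => //; apply: measurable_mulmx.
Qed.

Lemma volume_scaling_unitmx n (M : 'M[R]_n) : volume_scaling M -> M \in unitmx.
Proof. by case=> M0 _; rewrite unitmxE unitfE gt_eqF. Qed.

Let col_mx_affine k (l t : R) (c v : 'cV[R]_k) (M : 'M[R]_k) (b : 'cV[R]_(1 + k)) :
  block_mx (l%:M : 'M[R]_1) 0 c M *m col_mx (t%:M : 'cV[R]_1) v + b =
  col_mx ((l * t + usubmx b 0 0)%:M : 'cV[R]_1) (M *m v + (t *: c + dsubmx b)).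
Proof.
rewrite mul_block_col mul0mx addr0 -scalar_mxM mul_mx_scalar.
rewrite -[in LHS](vsubmxK b) add_col_mx; congr col_mx.
  by rewrite [in LHS](mx11_scalar (usubmx b)) raddfD.
by rewrite addrCA addrA.
Qed.

(** At first coordinate [t] the section of the preimage is an affine preimage under [M], shifted by
    [t *: c] and a constant. The hypothesis on [M] removes that map, and what remains is a
    one-dimensional affine substitution in [t]. *)
Lemma volume_scaling_block k (l : R) (c : 'cV[R]_k) (M : 'M[R]_k) :
  0 < l -> volume_scaling M ->
  volume_scaling (block_mx (l%:M : 'M[R]_1) 0 c M : 'M[R]_k.+1).
Proof.
move=> l0 [M0 MP]; split=> [|A b mA].
  by rewrite (@det_lblock _ 1 k) det_scalar expr1 mulr_gt0.
rewrite (@det_lblock _ 1 k) det_scalar expr1 EFinM.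
pose b1 := usubmx (b : 'cV[R]_(1 + k)) 0 0; pose b2 := dsubmx (b : 'cV[R]_(1 + k)).
pose S t := [set v : 'cV[R]_k | A (col_mx (t%:M : 'cV[R]_1) v)].
have mS t : measurable (S t).
  rewrite -[X in measurable X]setTI.
  have mf : measurable_fun setT (fun v : 'cV[R]_k => col_mx (t%:M : 'cV[R]_1) v).
    exact: (@measurable_col_mx R _ _ 1 k 1 (fun=> t%:M) id).
  exact: mf.
transitivity (l%:E * \int[lebesgue_measure]_t ((\det M)%:E *
   vol [set v | S (l * t + b1)%R (M *m v + (t *: c + b2))%R]))%E.
  have mA' := measurable_affine_preimage
    (block_mx (l%:M : 'M[R]_1) 0 c M : 'M[R]_k.+1) b mA.
  rewrite -muleA; congr (_ * _)%E.
  rewrite ge0_integralZl//; last by rewrite lee_fin ltW.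
    congr (_ * _)%E; apply: eq_integral => t _; congr (vol _).
    by apply/seteqP; split=> v; rewrite /S /= col_mx_affine.
  apply: eq_measurable_fun (measurable_lebesgue_volume_section mA') => t _ /=.
  by congr (vol _); apply/seteqP; split=> v; rewrite /S /= col_mx_affine.
under eq_integral do rewrite MP//.
rewrite -(@ge0_integral_affine _ l b1 (fun t => vol (S t)))//.
exact: measurable_lebesgue_volume_section.
Qed.

Lemma volume_scaling_scalar n (l : R) : 0 < l -> volume_scaling (l%:M : 'M[R]_n).
Proof.
move=> l0; elim: n => [|n IHn].
  split=> [|A b mA]; first by rewrite det_mx00.
  rewrite det_mx00 mul1e; congr (vol _); apply/seteqP; split=> v /=;
   by rewrite (_ : _ + b = v) //; apply/matrixP=> -[].
have := volume_scaling_block 0 l0 IHn.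
by rewrite -(@scalar_mx_block _ 1 n).
Qed.

Lemma volume_scaling1 n : volume_scaling (1%:M : 'M[R]_n).
Proof. exact: volume_scaling_scalar. Qed.

Lemma volume_scaling_mul n (M N : 'M[R]_n) :
  volume_scaling M -> volume_scaling N -> volume_scaling (M *m N).
Proof.
move=> [M0 MP] [N0 NP]; split; first by rewrite det_mulmx mulr_gt0.
move=> A b mA; rewrite det_mulmx EFinM -muleA -(MP _ b mA); congr (_ * _)%E.
rewrite -(NP _ 0 (measurable_affine_preimage M b mA)); congr (_ * vol _)%E.
by apply/seteqP; split=> v /=; rewrite addr0 mulmxA.
Qed.

(** The rule for [M] is applied to the preimage of [A] under the inverse; the composite is a
    translation, which preserves volume. *)
Lemma volume_scaling_inv n (M : 'M[R]_n) :
  volume_scaling M -> volume_scaling (invmx M).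
Proof.
move=> MM; have uM := volume_scaling_unitmx MM; case: MM => M0 MP.
split; first by rewrite det_inv invr_gt0.
move=> A b mA; rewrite det_inv.
rewrite -(MP _ 0 (measurable_affine_preimage (invmx M) b mA)).
rewrite muleA -EFinM mulVf ?gt_eqF// mul1e.
have [_ /(_ A b mA)] := volume_scaling1 n.
rewrite det1 mul1e => <-; congr (vol _).
by apply/seteqP; split=> v /=; rewrite addr0 mulKmx// mul1mx.
Qed.

Lemma posdefmx_unitmx n (C : 'M[R]_n) : posdefmx C -> C \in unitmx.
Proof.
move=> [_ C0]; rewrite -row_free_unit -kermx_eq0; apply/eqP/row_matrixP => i.
rewrite row0; apply/eqP/negPn/negP => r0.
have /C0 : (row i (kermx C))^T != 0.
  by apply: contra r0 => /eqP/(congr1 trmx); rewrite trmxK trmx0 => ->.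
by rewrite trmxK -row_mul mulmx_ker row0 mul0mx mxE ltxx.
Qed.

(** Induction through the Schur complement of the leading entry. *)
Lemma posdef_cholesky n (C : 'M[R]_n) : posdefmx C ->
  exists M : 'M[R]_n, volume_scaling M /\ M *m M^T = C.
Proof.
elim: n C => [C _|n IHn C [Csym Cpos]].
  exists 1%:M; split; last by rewrite (flatmx0 (_ *m _)) (flatmx0 C).
  exact: volume_scaling1.
pose a := ulsubmx (C : 'M[R]_(1 + n)) 0 0; pose c := dlsubmx (C : 'M[R]_(1 + n)).
pose D := drsubmx (C : 'M[R]_(1 + n)).
have Dsym : D^T = D by rewrite /D (@trmx_drsub _ 1 n 1 n) Csym.
have CE : C = block_mx (a%:M : 'M[R]_1) c^T c D :> 'M[R]_(1 + n).
  by rewrite /a -mx11_scalar /c (@trmx_dlsub _ 1 n 1 n) Csym submxK.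
have a0 : 0 < a.
  have := Cpos (col_mx (1%:M : 'M[R]_1) 0 : 'cV[R]_(1 + n)).
  rewrite CE (@tr_col_mx _ 1 n 1) trmx0 (@mul_row_block _ 1 1 n 1 n).
  rewrite !mul0mx !addr0 trmx1 !mul1mx (@mul_row_col _ 1 1 n 1) mulmx0 addr0.
  rewrite mulmx1 mxE eqxx mulr1n; apply.
  apply/eqP => /(congr1 (fun v : 'cV[R]_(1 + n) => usubmx v 0 0)).
  by rewrite col_mxKu linear0 !mxE eqxx => /eqP; rewrite oner_eq0.
have [|M' [M'vol M'E]] := IHn (D - a^-1 *: (c *m c^T)).
  split; first by rewrite linearB/= linearZ/= trmx_mul trmxK Dsym.
  move=> v v0.
  (* Among vectors with lower part [v] this one minimises the quadratic form of [C], and its value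
     is the form of the Schur complement at [v]. *)
  have := Cpos (col_mx (- (a^-1 *: (c^T *m v))) v : 'cV[R]_(1 + n)).
  have uT : (- (a^-1 *: (c^T *m v)))^T = - (a^-1 *: (v^T *m c)).
    by rewrite linearN/= linearZ/= trmx_mul trmxK.
  rewrite CE (@tr_col_mx _ 1 n 1) (@mul_row_block _ 1 1 n 1 n) uT.
  rewrite mul_mx_scalar scalerN scalerA mulfV ?gt_eqF// scale1r addNr.
  rewrite (@mul_row_col _ 1 1 n 1) mul0mx add0r.
  rewrite mulNmx -scalemxAl addrC -(mulmxA _ c) (scalemxAr _ v^T) -mulmxBr; apply.
  apply: contra v0 => /eqP/(congr1 (fun v : 'cV[R]_(1 + n) => dsubmx v)).
  by rewrite col_mxKd linear0 => ->.
exists (block_mx ((Num.sqrt a)%:M : 'M[R]_1) 0 ((Num.sqrt a)^-1 *: c) M'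
  : 'M[R]_(1 + n)).
split; first by apply: volume_scaling_block => //; rewrite sqrtr_gt0.
rewrite (@tr_block_mx _ 1 n 1 n) (@mulmx_block _ 1 n 1 n 1 n).
rewrite trmx0 !mulmx0 !mul0mx !addr0.
rewrite M'E CE tr_scalar_mx linearZ/= -scalar_mxM -expr2 sqr_sqrtr ?ltW//.
have s0 : Num.sqrt a != 0 by rewrite gt_eqF// sqrtr_gt0.
rewrite mul_scalar_mx scalerA mulfV// scale1r mul_mx_scalar scalerA mulfV// scale1r.
rewrite -scalemxAl -scalemxAr scalerA -expr2 exprVn sqr_sqrtr ?ltW//.
by rewrite addrC subrK.
Qed.

End volume_scaling.

(** * Volumes of boxes and balls *)

Section fubini_sections.
Context d1 d2 (T1 : measurableType d1) (T2 : measurableType d2) (R : realType).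
Variables (m1 : {sigma_finite_measure set T1 -> \bar R}).
Variables (m2 : {sigma_finite_measure set T2 -> \bar R}).

(** Both iterated integrals define measures with the same values on rectangles, hence the same
    product measure. *)
Lemma integral_xsection_ysection (E : set (T1 * T2)) : measurable E ->
  (\int[m1]_x m2 (xsection E x) = \int[m2]_y m1 (ysection E y))%E.
Proof.
move=> mE; have := @product_measure_unique _ _ _ _ _ m1 m2
  (lebesgue_integral_fubini_product_measure2__canonical__measure_function_Measure
    m1 m2) _ E mE.
by apply => A B mA mB /=; rewrite product_measure2E.
Qed.

End fubini_sections.

Section volume_of_boxes.
Context {R : realType}.
Local Notation vol := (@lebesgue_volume R _).
Local Open Scope ereal_scope.

Lemma measurable_prod_coord n (g : 'I_n -> R -> R) :
  (forall i, measurable_fun setT (g i)) ->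
  measurable_fun setT (fun v : 'cV[R]_n => (\prod_i g i (v i 0))%:E).
Proof.
move=> mg; apply/measurable_EFinP; apply: measurable_prod => i _.
by apply: (measurableT_comp (mg i)); exact: measurable_mx_entry.
Qed.

Lemma ge0_integral_prod_coord n (g : 'I_n -> R -> R) :
  (forall i, measurable_fun setT (g i)) -> (forall i t, 0 <= g i t)%R ->
  \int[@lebesgue_volume R n]_v (\prod_i g i (v i 0))%:E =
  \prod_i \int[lebesgue_measure]_t (g i t)%:E.
Proof.
elim: n g => [|n IHn] g mg g0.
  rewrite big_ord0; under eq_integral do rewrite big_ord0.
  by rewrite integral_cst//= mul1e indicE in_setT.
rewrite ge0_integral_lebesgue_volumeS; last 2 first.
- exact: measurable_prod_coord.
- by move=> v; rewrite lee_fin prodr_ge0.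
rewrite [RHS]big_ord_recl -(IHn (fun i => g (lift ord0 i)))//.
rewrite muleC -ge0_integralZl//; first last.
- by apply: integral_ge0 => v _; rewrite lee_fin prodr_ge0.
- by move=> t _; rewrite lee_fin.
- by apply/measurable_EFinP; exact: mg.
apply: eq_integral => t _.
rewrite muleC -ge0_integralZl ?lee_fin//; first last.
- by move=> v _; rewrite lee_fin prodr_ge0.
- exact: (measurable_prod_coord (g := fun i => g (lift ord0 i))).
apply: eq_integral => v _; rewrite -EFinM big_ord_recl; congr (_ * _)%:E.
  have -> : ord0 = lshift n (ord0 : 'I_1) :> 'I_n.+1 by exact/val_inj.
  by rewrite (@col_mxEu _ 1) mxE eqxx mulr1n.
apply: eq_bigr => i _; congr (g _ _).
have -> : lift ord0 i = rshift 1 i :> 'I_n.+1 by exact/val_inj.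
by rewrite (@col_mxEd _ 1).
Qed.

Lemma indic_box n (B : 'I_n -> set R) v :
  \1_(box B) v = (\prod_i \1_(B i) (v i 0))%R :> R.
Proof.
rewrite indicE; have [/[!inE] Bv|nBv] := boolP (v \in box B).
  by rewrite big1// => i _; rewrite indicE mem_set.
have [i nBi] : exists i, ~ B i (v i 0%R).
  by apply/existsNP; move: nBv; apply: contraNnot => ?; rewrite inE.
by rewrite (bigD1 i)//= indicE memNset// mul0r.
Qed.

Lemma lebesgue_volume_box n (B : 'I_n -> set R) : (forall i, measurable (B i)) ->
  vol (box B) = \prod_i lebesgue_measure (B i).
Proof.
move=> mB; rewrite -[X in vol X]setIT -integral_indic//; last exact: measurable_box.
under eq_integral do rewrite indic_box.
rewrite (ge0_integral_prod_coord (g := fun i => \1_(B i)))//.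
apply: eq_bigr => i _; rewrite integral_indic//; last exact: mB.
by congr (lebesgue_measure _); exact: setIT.
Qed.

End volume_of_boxes.

Section euclidean_ball.
Context {R : realType}.
Local Notation vol := (@lebesgue_volume R _).

Definition sqnorm n (v : 'cV[R]_n) : R := (v^T *m v) 0 0.

Lemma sqnormE n (v : 'cV[R]_n) : sqnorm v = \sum_i v i 0 ^+ 2.
Proof. by rewrite /sqnorm mxE; apply: eq_bigr => i _; rewrite mxE expr2. Qed.

Lemma sqnorm_ge0 n (v : 'cV[R]_n) : 0 <= sqnorm v.
Proof. by rewrite sqnormE sumr_ge0// => i _; rewrite sqr_ge0. Qed.

Lemma sqnormN n (v : 'cV[R]_n) : sqnorm (- v) = sqnorm v.
Proof. by rewrite !sqnormE; apply: eq_bigr => i _; rewrite mxE sqrrN. Qed.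

Lemma sqnormZ n a (v : 'cV[R]_n) : sqnorm (a *: v) = a ^+ 2 * sqnorm v.
Proof.
by rewrite !sqnormE mulr_sumr; apply: eq_bigr => i _; rewrite mxE exprMn.
Qed.

Lemma sqnorm_orthogonal n (U : 'M[R]_n) v : U^T *m U = 1%:M ->
  sqnorm (U *m v) = sqnorm v.
Proof. by move=> UU; rewrite /sqnorm trmx_mul mulmxA -(mulmxA v^T) UU mulmx1. Qed.

Lemma measurable_sqnorm n : measurable_fun setT (@sqnorm n).
Proof.
apply: (measurableT_comp (measurable_mx_entry 0 0)).
by apply: measurable_mulmx => //; exact: measurable_trmx.
Qed.

Definition cball n (rho : R) : set 'cV[R]_n := [set v | sqnorm v <= rho].

Lemma measurable_cball n rho : measurable (@cball n rho).
Proof.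
rewrite -[X in measurable X]setTI.
rewrite (_ : cball _ = @sqnorm n @^-1` `]-oo, rho]); last first.
  by apply/seteqP; split => v; rewrite /cball/= in_itv.
exact: measurable_sqnorm.
Qed.

Lemma vol_cball_fin n rho : (vol (@cball n rho) < +oo)%E.
Proof.
(* The summand 1 gives [r <= r ^+ 2], so [r] bounds the coordinates without a square root. *)
pose r : R := `|rho| + 1.
have r1 : 1 <= r by rewrite /r lerDr.
have sB : @cball n rho `<=` box (fun=> `[- r, r]%classic).
  move=> v /= vr i; rewrite /= in_itv/= -ler_norml.
  have r0 : 0 <= r by rewrite (le_trans ler01).
  rewrite -ler_sqr ?nnegrE//= real_normK ?num_real//.
  have : v i 0 ^+ 2 <= r.
    rewrite (le_trans _ (_ : rho <= _)) ?(le_trans (ler_norm rho))// ?lerDl//.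
    apply: le_trans vr; rewrite sqnormE (bigD1 i)//= lerDl sumr_ge0// => j _.
    exact: sqr_ge0.
  by move/le_trans; apply; rewrite expr2 ler_peMl.
apply: (@le_lt_trans _ _ (vol (box (fun=> `[- r, r]%classic : set R)))).
  apply: le_measure => //; rewrite inE; last exact: measurable_box.
  exact: measurable_cball.
rewrite lebesgue_volume_box//.
under eq_bigr do
  rewrite lebesgue_measure_itv/= lte_fin gtrN ?(lt_le_trans ltr01)// -EFinD.
by rewrite prodEFin ltry.
Qed.

Lemma vol_cball_gt0 n rho : 0 < rho -> (0 < vol (@cball n rho))%E.
Proof.
(* Since [e <= 1], squares on [[0, e]] are at most [e], and [n] of them sum to at most [rho]. The
   denominator [n.+1] stays positive for [n = 0]. *)
move=> rho0; pose e := Num.min 1 (rho / n.+1%:R).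
have e0 : 0 < e by rewrite lt_min ltr01 divr_gt0.
have sB : box (fun=> `[0, e]%classic) `<=` @cball n rho.
  move=> v vB; rewrite /cball/= sqnormE.
  apply: (@le_trans _ _ (\sum_(i < n) (rho / n.+1%:R))).
    apply: ler_sum => i _; have := vB i; rewrite /= in_itv/= => /andP[vi0].
    rewrite le_min => /andP[vi1 vir]; apply: le_trans vir.
    by rewrite expr2 ler_piMl.
  rewrite sumr_const card_ord -[leLHS]mulr_natr mulrAC ler_pdivrMr//.
  by rewrite ler_wpM2l ?ler_nat// ltW.
apply: (@lt_le_trans _ _ (vol (box (fun=> `[0, e]%classic : set R)))); last first.
  apply: le_measure => //; rewrite inE; first exact: measurable_box.
  exact: measurable_cball.
rewrite lebesgue_volume_box//.
under eq_bigr do rewrite lebesgue_measure_itv/= lte_fin e0 -EFinD subr0.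
by rewrite prodEFin lte_fin prodr_gt0.
Qed.

(* Fubini counts the pairs [(x, y)] with [x] in the unit ball [B] and [x + U y] in [A]
   in two ways; translation invariance gives [vol B * vol (U^-1 A)] and
   [vol B * vol A]. *)
Lemma lebesgue_volume_orthogonal n (U : 'M[R]_n) (A : set 'cV[R]_n) :
  U^T *m U = 1%:M -> measurable A -> vol [set v | A (U *m v)] = vol A.
Proof.
move=> UU mA; have UU' := mulmx1C UU.
pose B : set 'cV[R]_n := cball 1.
have mB : measurable B by exact: measurable_cball.
have volT (E : set 'cV[R]_n) b : measurable E -> vol [set v | E (v + b)] = vol E.
  move=> mE; have [_ /(_ E b mE)] := @volume_scaling1 R n; rewrite det1 mul1e => <-.
  by congr (vol _); apply/seteqP; split=> v /=; rewrite mul1mx.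
have mUA : measurable [set v | A (U *m v)].
  have := measurable_affine_preimage U 0 mA.
  by congr measurable; apply/seteqP; split=> v /=; rewrite addr0.
have mU : measurable_fun setT (fun p : 'cV[R]_n * 'cV[R]_n => U *m p.2).
  by apply: measurable_mulmx.
pose D := [set p : 'cV[R]_n * 'cV[R]_n | B p.1] `&` [set p | A (p.1 + U *m p.2)].
pose D' := [set p : 'cV[R]_n * 'cV[R]_n | B (p.1 - U *m p.2)] `&` [set p | A p.1].
have mD : measurable D.
  apply: measurableI; rewrite -[X in measurable X]setTI.
    exact: measurable_fst.
  by apply: (measurable_addmx measurable_fst mU).
have mD' : measurable D'.
  apply: measurableI; rewrite -[X in measurable X]setTI.
    by apply: (measurable_submx measurable_fst mU).
  exact: measurable_fst.
have integral_indicM (E : set 'cV[R]_n) a : measurable E -> (0 <= a)%E ->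
    (\int[vol]_x (a * (\1_E x)%:E) = a * vol E)%E.
  move=> mE a0; rewrite ge0_integralZl//; last exact/measurable_EFinP.
  by rewrite integral_indic// setIT.
have E1 : (\int[vol]_x vol (xsection D x) = vol [set v | A (U *m v)] * vol B)%E.
  rewrite -integral_indicM//; apply: eq_integral => x _.
  rewrite indicE; have [/[!inE] Bx|] := boolP (x \in B).
    rewrite mule1 -(volT _ (U^T *m x) mUA); congr (vol _).
    apply/seteqP; split=> y; rewrite /xsection/= inE /D/=.
      by case=> _; rewrite mulmxDr mulmxA UU' mul1mx addrC.
    by rewrite mulmxDr mulmxA UU' mul1mx addrC.
  move=> /negP nBx; rewrite mule0 (_ : xsection _ _ = set0) ?measure0//.
  by apply/seteqP; split=> y //; rewrite /xsection/= inE => -[/= ? _];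
    apply: nBx; rewrite inE.
have E2 : (\int[vol]_x vol (xsection D' x) = vol B * vol A)%E.
  rewrite -integral_indicM//; apply: eq_integral => x _.
  rewrite indicE; have [/[!inE] Ax|] := boolP (x \in A).
    rewrite mule1 -(volT _ (- (U^T *m x)) mB); congr (vol _).
    have xyE y : sqnorm (x - U *m y) = sqnorm (y - U^T *m x).
      rewrite -(sqnorm_orthogonal (U:=U^T)) ?trmxK// mulmxBr mulmxA UU mul1mx.
      by rewrite -sqnormN opprB.
    apply/seteqP; split=> y; rewrite /xsection/= inE /D'/= /B/cball/=.
      by case=> + _; rewrite xyE.
    by rewrite xyE.
  move=> /negP nAx; rewrite mule0 (_ : xsection _ _ = set0) ?measure0//.
  by apply/seteqP; split=> y //; rewrite /xsection/= inE => -[_ /= ?];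
    apply: nAx; rewrite inE.
have E3 : (\int[vol]_x vol (xsection D x) = \int[vol]_x vol (xsection D' x))%E.
  (* For fixed [y] the section of [D'] is that of [D] translated by [U *m y]. *)
  rewrite !integral_xsection_ysection//; apply: eq_integral => y _.
  apply: (etrans (esym (volT _ (- (U *m y)) (measurable_ysection _ mD)))).
  congr (vol _).
  by apply/seteqP; split=> x; rewrite /ysection/= !inE /D/D'/= subrK.
have := vol_cball_fin n 1; have := vol_cball_gt0 n ltr01.
rewrite -/B; move: E3; rewrite E1 E2.
move=> E volB0 volBoo.
have volBfin : vol B \is a fin_num by rewrite ge0_fin_numE.
rewrite (muleC _ (vol B)) in E.
by apply/eqP; rewrite eq_le; apply/andP; split;
  rewrite -(lee_pmul2l volBfin volB0) E.
Qed.

End euclidean_ball.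

(** * The standard Gaussian measure *)

Section standard_gaussian_measure.
Context {R : realType}.
Local Notation vol := (@lebesgue_volume R _).

(** Here [normal_peak 1] is 1 / sqrt(2 pi). The dependence on [sqnorm] alone exhibits both rotation
    invariance and the level sets. *)
Definition gauss_pdf n (v : 'cV[R]_n) : R :=
  normal_peak 1 ^+ n * expR (- (sqnorm v / 2)).

Lemma gauss_pdf_gt0 n (v : 'cV[R]_n) : 0 < gauss_pdf v.
Proof. by rewrite mulr_gt0 ?expR_gt0// exprn_gt0// normal_peak_gt0. Qed.

Lemma gauss_pdf_ge0 n (v : 'cV[R]_n) : 0 <= gauss_pdf v.
Proof. exact/ltW/gauss_pdf_gt0. Qed.

Lemma gauss_pdf_prod n (v : 'cV[R]_n) :
  gauss_pdf v = \prod_i normal_pdf 0 1 (v i 0).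
Proof.
rewrite /gauss_pdf sqnormE mulr_suml -sumrN expR_sum.
rewrite -[X in _ ^+ X]card_ord -prodr_const -big_split/=.
apply: eq_bigr => i _; rewrite normal_pdfE ?oner_eq0//= /normal_fun.
by rewrite subr0 expr1n mulNr.
Qed.

Lemma measurable_gauss_pdf n : measurable_fun setT (@gauss_pdf n).
Proof.
apply: measurable_funM => //; apply: measurableT_comp => //.
apply: measurable_funN; apply: measurable_funM => //.
exact: measurable_sqnorm.
Qed.

Definition gauss_measure n (A : set 'cV[R]_n) : \bar R :=
  (\int[vol]_(v in A) (gauss_pdf v)%:E)%E.

Let gauss_measure0 n : @gauss_measure n set0 = 0%E.
Proof. by rewrite /gauss_measure integral_set0. Qed.

Let gauss_measure_ge0 n A : (0 <= @gauss_measure n A)%E.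
Proof. by apply: integral_ge0 => v _; rewrite lee_fin gauss_pdf_ge0. Qed.

Let gauss_measure_sigma_additive n : semi_sigma_additive (@gauss_measure n).
Proof.
move=> /= A mA tA mUA; rewrite /gauss_measure ge0_integral_bigcup//=.
- by apply: is_cvg_ereal_nneg_natsum_cond => k _ _; exact: gauss_measure_ge0.
- by apply: measurable_funTS; apply/measurable_EFinP; exact: measurable_gauss_pdf.
- by move=> v _; rewrite lee_fin gauss_pdf_ge0.
Qed.

HB.instance Definition _ n := isMeasure.Build _ _ _ (@gauss_measure n)
  (gauss_measure0 n) (@gauss_measure_ge0 n) (@gauss_measure_sigma_additive n).

Lemma gauss_measureE n (A : set 'cV[R]_n) : measurable A ->
  gauss_measure A = (\int[vol]_v (gauss_pdf v * \1_A v)%:E)%E.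
Proof.
move=> mA; rewrite /gauss_measure integral_mkcond; apply: eq_integral => v _.
by rewrite patchE indicE; case: ifPn; rewrite ?mulr1 ?mulr0.
Qed.

(** Links the density to the box probabilities of [standard_gaussian]: density and indicator both
    factor over the coordinates. *)
Lemma gauss_measure_box n (B : 'I_n -> set R) : (forall i, measurable (B i)) ->
  gauss_measure (box B) = (\prod_i normal_prob 0 1 (B i))%E.
Proof.
move=> mB; rewrite gauss_measureE; last exact: measurable_box.
pose g i t := normal_pdf 0 1 t * \1_(B i) t : R.
transitivity (\int[vol]_v (\prod_i g i (v i 0))%:E)%E.
  by apply: eq_integral => v _; rewrite gauss_pdf_prod indic_box -big_split.
rewrite ge0_integral_prod_coord.
- apply: eq_bigr => i _; rewrite /normal_prob [RHS]integral_mkcond.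
  apply: eq_integral => t _; rewrite patchE /g indicE.
  by case: ifPn; rewrite ?mulr1 ?mulr0.
- move=> i; apply: measurable_funM; first exact: measurable_normal_pdf.
  by apply: measurable_indic; exact: mB.
- by move=> i t; rewrite /g mulr_ge0 ?normal_pdf_ge0.
Qed.

Let gauss_measure_setT n : gauss_measure [set: 'cV[R]_n] = 1%E.
Proof.
rewrite -(boxT n) gauss_measure_box//.
by under eq_bigr do rewrite probability_setT; rewrite prodEFin big1.
Qed.

HB.instance Definition _ n :=
  Measure_isProbability.Build _ _ R (@gauss_measure n) (gauss_measure_setT n).

(** The density depends on [sqnorm] only, and volume is invariant under [U]. *)
Lemma gauss_measure_orthogonal n (U : 'M[R]_n) (A : set 'cV[R]_n) :
  U^T *m U = 1%:M -> measurable A ->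
  gauss_measure [set v | A (U *m v)] = gauss_measure A.
Proof.
move=> UU mA.
have mU : measurable_fun setT (fun v : 'cV[R]_n => U *m v).
  by apply: measurable_mulmx.
have mUA : measurable [set v | A (U *m v)].
  by rewrite -[X in measurable X]setTI; exact: mU.
rewrite !gauss_measureE//.
rewrite [RHS](@ge0_integral_image _ _ _ _ _ (@lebesgue_volume R n) _ _ mU).
- apply: eq_integral => v _ /=.
  by rewrite /gauss_pdf sqnorm_orthogonal// !indicE !inE.
- by move=> E mE; apply/esym; exact: lebesgue_volume_orthogonal.
- apply/measurable_EFinP; apply: measurable_funM; first exact: measurable_gauss_pdf.
  exact: measurable_indic.
- by move=> v; rewrite lee_fin mulr_ge0 ?gauss_pdf_ge0.
Qed.

End standard_gaussian_measure.

Section standard_gaussian_law.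
Context {disp : measure_display} {Omega : measurableType disp} {R : realType}.
Variable P : probability Omega R.

Lemma standard_gaussian_law k (Z : {RV P >-> 'cV[R]_k}) (A : set 'cV[R]_k) :
  standard_gaussian Z -> measurable A -> P (Z @^-1` A) = gauss_measure A.
Proof.
move=> Zstd mA.
have mZ : measurable_fun setT Z by [].
have -> : P (Z @^-1` A) = distribution P Z A by [].
apply: (@box_measure_unique R k (distribution P Z) (@gauss_measure R k)) => //.
  by apply: le_lt_trans (probability_le1 _ _) _ => //; exact: ltry.
move=> B mB; apply: etrans (Zstd B mB) _; apply/esym.
exact: gauss_measure_box.
Qed.

Lemma standard_gaussian_orthogonal k (Z : {RV P >-> 'cV[R]_k}) (U : 'M[R]_k)
    (A : set 'cV[R]_k) : standard_gaussian Z -> U^T *m U = 1%:M -> measurable A ->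
  P [set w | A (U *m Z w)] = P [set w | A (Z w)].
Proof.
move=> Zstd UU mA.
have mUA : measurable [set v | A (U *m v)].
  rewrite -[X in measurable X]setTI.
  by apply: (_ : measurable_fun setT (fun v : 'cV[R]_k => U *m v)) => //;
    exact: measurable_mulmx.
rewrite (standard_gaussian_law Zstd mA) -(gauss_measure_orthogonal UU mA).
exact: standard_gaussian_law.
Qed.

End standard_gaussian_law.

Section integral_le_ae_eq.
Context d (T : measurableType d) (R : realType) (mu : {measure set T -> \bar R}).
Local Open Scope ereal_scope.

(** The difference [g - f] is nonnegative with zero integral. Finite values of [f] make the
    subtraction meaningful, and its finite integral can be cancelled. *)
Lemma ge0_le_integral_ae_eq (f g : T -> \bar R) :
  measurable_fun setT f -> measurable_fun setT g ->
  (forall x, f x \is a fin_num) -> (forall x, 0 <= f x) ->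
  (forall x, f x <= g x) ->
  \int[mu]_x f x < +oo -> \int[mu]_x g x <= \int[mu]_x f x ->
  {ae mu, forall x, f x = g x}.
Proof.
move=> mf mg ffin f0 fg foo gf.
have h0 x : 0 <= g x - f x by rewrite sube_ge0 ?ffin.
have mh : measurable_fun setT (fun x => g x - f x) by exact: emeasurable_funB.
have gE : \int[mu]_x g x = \int[mu]_x f x + \int[mu]_x (g x - f x).
  rewrite -ge0_integralD//; apply: eq_integral => x _.
  by rewrite addeC subeK.
have hI : \int[mu]_x `|g x - f x| = 0.
  under eq_integral do rewrite gee0_abs//.
  apply/eqP; rewrite eq_le integral_ge0// andbT.
  have fI : \int[mu]_x f x \is a fin_num.
    by rewrite ge0_fin_numE// integral_ge0.
  by move: gf; rewrite gE -[leRHS]adde0 leeD2lE.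
have /(_ hI) := (ae_eq_integral_abs mu measurableT mh).1.
apply: filterS => x /(_ I)/= gf0.
by rewrite -(subeK (g x) (ffin x)) gf0 add0e.
Qed.

End integral_le_ae_eq.

(** * The Neyman-Pearson comparison *)

Section neyman_pearson.
Context {R : realType}.
Local Notation vol := (@lebesgue_volume R _).

Definition gauss_level n (rho : R) : R := normal_peak 1 ^+ n * expR (- (rho / 2)).

Lemma gauss_level_gt0 n rho : 0 < gauss_level n rho.
Proof. by rewrite mulr_gt0 ?expR_gt0// exprn_gt0// normal_peak_gt0. Qed.

Lemma gauss_level_lt n rho (v : 'cV[R]_n) :
  (gauss_level n rho < gauss_pdf v) = (sqnorm v < rho).
Proof.
rewrite /gauss_level /gauss_pdf ltr_pM2l ?exprn_gt0 ?normal_peak_gt0//.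
by rewrite ltr_expR ltrN2 ltr_pM2r ?invr_gt0.
Qed.

Lemma gauss_pdf_lt n rho (v : 'cV[R]_n) :
  (gauss_pdf v < gauss_level n rho) = (rho < sqnorm v).
Proof.
rewrite /gauss_level /gauss_pdf ltr_pM2l ?exprn_gt0 ?normal_peak_gt0//.
by rewrite ltr_expR ltrN2 ltr_pM2r ?invr_gt0.
Qed.

Section fixed_set.
Variables (n : nat) (rho : R) (E : set 'cV[R]_n).
Hypothesis mE : measurable E.
Let t := gauss_level n rho.
Let B : set 'cV[R]_n := cball rho.
(** Volumes may be infinite, so the subtracted terms are moved to the other side. Then [g - f]
    factors as [(gauss_pdf v - t) * (\1_B v - \1_E v)], whose factors never have opposite signs. *)
Let f v : R := gauss_pdf v * \1_E v + t * \1_B v.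
Let g v : R := gauss_pdf v * \1_B v + t * \1_E v.

Let mB : measurable B. Proof. exact: measurable_cball. Qed.

Let fgE v : g v - f v = (gauss_pdf v - t) * (\1_B v - \1_E v).
Proof. by rewrite /f /g; ring. Qed.

Let in_B v : (v \in B) = (sqnorm v <= rho).
Proof. by apply/idP/idP => [|?]; rewrite inE. Qed.

Let mh1 (A : set 'cV[R]_n) : measurable A ->
  measurable_fun setT (fun v => (gauss_pdf v * \1_A v)%:E).
Proof.
move=> mA; apply/measurable_EFinP; apply: measurable_funM.
  exact: measurable_gauss_pdf.
exact: measurable_indic.
Qed.

Let mh2 (A : set 'cV[R]_n) : measurable A ->
  measurable_fun setT (fun v => (t * \1_A v)%:E).
Proof.
move=> mA; apply/measurable_EFinP; exact: measurable_funM.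
Qed.

Let integralE (A1 A2 : set 'cV[R]_n) : measurable A1 -> measurable A2 ->
  (\int[vol]_v (gauss_pdf v * \1_A1 v + t * \1_A2 v)%:E
   = gauss_measure A1 + t%:E * vol A2)%E.
Proof.
move=> mA1 mA2; rewrite gauss_measureE//.
under eq_integral do rewrite EFinD.
rewrite ge0_integralD//; first last.
- exact: mh2.
- by move=> v _; rewrite lee_fin mulr_ge0// ltW// gauss_level_gt0.
- exact: mh1.
- by move=> v _; rewrite lee_fin mulr_ge0// gauss_pdf_ge0.
- congr (_ + _)%E; under eq_integral do rewrite EFinM.
  rewrite ge0_integralZl//; last by rewrite lee_fin ltW// gauss_level_gt0.
    by rewrite integral_indic// setIT.
  by apply/measurable_EFinP; exact: measurable_indic.
Qed.

Let f_ge0 v : 0 <= f v.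
Proof.
have indic_ge0 (A : set 'cV[R]_n) : 0 <= \1_A v :> R by rewrite indicE ler0n.
have t0 : 0 <= t by exact/ltW/gauss_level_gt0.
exact: addr_ge0 (mulr_ge0 (gauss_pdf_ge0 v) (indic_ge0 E)) (mulr_ge0 t0 (indic_ge0 B)).
Qed.

Let f_le_g v : f v <= g v.
Proof.
rewrite -subr_ge0 fgE !indicE in_B.
have [vB|vB] := leP (sqnorm v) rho.
  rewrite mulr_ge0//; last by case: (v \in E); rewrite ?subrr ?subr0 ?ler01.
  by rewrite subr_ge0 leNgt gauss_pdf_lt -leNgt.
rewrite mulr_le0//; last by case: (v \in E); rewrite ?subrr ?sub0r ?lerN10.
by rewrite subr_le0 ltW// gauss_pdf_lt.
Qed.

Lemma neyman_pearson :
  (gauss_measure E + t%:E * vol (cball rho : set 'cV[R]_n) <=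
   gauss_measure (cball rho : set 'cV[R]_n) + t%:E * vol E)%E.
Proof.
rewrite -!integralE//; apply: ge0_le_integral => //.
- by move=> v _; rewrite lee_fin; exact: f_ge0.
- under eq_fun do rewrite EFinD.
  by apply: emeasurable_funD; [exact: mh1|exact: mh2].
- under eq_fun do rewrite EFinD.
  by apply: emeasurable_funD; [exact: mh1|exact: mh2].
- by move=> v _; rewrite lee_fin f_le_g.
Qed.

(** The reverse inequality forces [f = g] almost everywhere, whereas both factors of [g - f] are
    nonzero on [S]. Strict inequalities keep [S] off the sphere, where the density equals [t]. *)
Lemma neyman_pearson_eq (S : set 'cV[R]_n) : measurable S ->
  (gauss_measure (cball rho : set 'cV[R]_n) + t%:E * vol E <=
   gauss_measure E + t%:E * vol (cball rho : set 'cV[R]_n))%E ->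
  (forall v, S v -> E v /\ rho < sqnorm v \/ ~ E v /\ sqnorm v < rho) ->
  vol S = 0%E.
Proof.
move=> mS; rewrite -!integralE// => gf SE.
have : {ae vol, forall v : 'cV[R]_n, (f v)%:E = (g v)%:E}.
  apply: ge0_le_integral_ae_eq => //.
  - under eq_fun do rewrite EFinD.
    by apply: emeasurable_funD; [exact: mh1|exact: mh2].
  - under eq_fun do rewrite EFinD.
    by apply: emeasurable_funD; [exact: mh1|exact: mh2].
  - rewrite integralE//; apply: lte_add_pinfty.
      by apply: le_lt_trans (probability_le1 _ _) _ => //; exact: ltry.
    rewrite lte_mul_pinfty// ?lee_fin ?ltW ?gauss_level_gt0//.
    exact: vol_cball_fin.
move=> [N [mN N0 sub]].
apply/eqP; rewrite -measure_le0 -N0; apply: le_measure; rewrite ?inE// => v Sv.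
apply: sub => /= -[] fgv; have := fgE v; rewrite fgv subrr !indicE in_B.
move/esym/eqP; have [[Ev nv]|[nEv nv]] := SE _ Sv.
  rewrite leNgt nv mem_set//= sub0r mulrN1 oppr_eq0 subr_eq0 => /eqP E0.
  by move: nv; rewrite -(gauss_pdf_lt _ v) -/t E0 ltxx.
rewrite ltW// memNset//= subr0 mulr1 subr_eq0 => /eqP E0.
by move: nv; rewrite -(gauss_level_lt _ v) -/t E0 ltxx.
Qed.

End fixed_set.
End neyman_pearson.

(** * The equality case for ellipsoids *)

Section ellipsoid_rigidity.
Import numFieldNormedType.Exports.
Context {R : realType}.
Local Notation vol := (@lebesgue_volume R _).

(** Balls of the matrix topology are entrywise, so a ball around [p] is a box of intervals of
    positive length. *)
Lemma nbhs_volume_neq0 n (p : 'cV[R]_n) (S : set 'cV[R]_n) :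
  measurable S -> nbhs p S -> vol S <> 0%E.
Proof.
move=> mS /nbhs_ballP [e /= e0 es] S0.
have sB : box (fun i => ball (p i 0) e) `<=` S.
  by move=> v vB; apply: es; split=> // i j; rewrite (ord1 j); exact: vB.
have mB i : measurable (ball (p i 0) e) by exact: measurable_ball.
have : (vol (box (fun i => ball (p i 0%R) e)) <= 0)%E.
  by rewrite -S0; apply: le_measure => //; rewrite inE//; exact: measurable_box.
rewrite lebesgue_volume_box//.
under eq_bigr do rewrite lebesgue_measure_ball ?ltW//.
by rewrite prodEFin lee_fin leNgt prodr_gt0// => i _; rewrite pmulrn_lgt0.
Qed.

Lemma continuous_sqnorm_affine n (M : 'M[R]_n) (c : 'cV[R]_n) :
  continuous (fun v : 'cV[R]_n => sqnorm (M *m v + c)).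
Proof.
have cont_sum (I : Type) (r : seq I) (F : I -> 'cV[R]_n -> R) :
    (forall i, continuous (F i)) -> continuous (fun v => \sum_(i <- r) F i v).
  by move=> cF; apply: continuous_big => //; exact: add_continuous.
have coordc i j : continuous (fun v : 'cV[R]_n => (M *m v + c) i j).
  have -> : (fun v : 'cV[R]_n => (M *m v + c) i j) =
      (fun v => \sum_k M i k * v k j) + cst (c i j).
    by apply/funext => v; rewrite !mxE.
  move=> v; apply: continuousD; last exact: cst_continuous.
  apply: cont_sum => k w; apply: continuousM; first exact: cst_continuous.
  exact: coord_continuous.
under eq_fun do rewrite sqnormE.
apply: cont_sum => i v; under eq_fun do rewrite expr2.
by apply: continuousM; exact: coordc.
Qed.

Lemma sqnormDZ n (u w : 'cV[R]_n) s :
  sqnorm (u + s *: w) =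
  sqnorm u + s * (\sum_i u i 0 * w i 0) *+ 2 + s ^+ 2 * sqnorm w.
Proof.
rewrite !sqnormE !mulr_sumr -sumrMnl -!big_split/=; apply: eq_bigr => i _.
by rewrite !mxE; ring.
Qed.

Lemma sqnorm_perturb n (u w : 'cV[R]_n) r : r < sqnorm u ->
  exists s, [/\ 0 < s, s < 1 & r < sqnorm (u + s *: w)].
Proof.
move=> ru; pose a := \sum_i u i 0 * w i 0; pose d := sqnorm u - r.
have d0 : 0 < d by rewrite subr_gt0.
have a0 : 0 <= `|a| by [].
have D0 : 0 < `|a| *+ 2 + d + 1 by lra.
(* This [s] makes the linear term, at most [s * (2 * |a|)] in absolute value, smaller than the slack
   [d]; the quadratic term only helps. *)
exists (d / (`|a| *+ 2 + d + 1)); split.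
- by rewrite divr_gt0.
- by rewrite ltr_pdivrMr// mul1r; lra.
rewrite sqnormDZ -/a; set s := _ / _.
have s0 : 0 < s by rewrite divr_gt0.
have sE : s * (`|a| *+ 2) < d.
  by rewrite /s mulrAC ltr_pdivrMr// ltr_pM2l//; lra.
have sa : - (s * `|a|) <= s * a.
  by rewrite -mulrN ler_pM2l// lerNl -normrN ler_norm.
have sw : 0 <= s ^+ 2 * sqnorm w by rewrite mulr_ge0 ?sqr_ge0 ?sqnorm_ge0.
rewrite /d in sE.
lra.
Qed.

Lemma sqnorm_eq0 n (v : 'cV[R]_n) : (sqnorm v == 0) = (v == 0).
Proof.
apply/eqP/eqP => [|->]; last by rewrite /sqnorm mulmx0 mxE.
rewrite sqnormE => /eqP; rewrite psumr_eq0 => [/allP v0|i _]; last exact: sqr_ge0.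
apply/colP => i; have := v0 i; rewrite mem_index_enum sqrf_eq0 mxE => /(_ isT).
by move/eqP.
Qed.

(** Polarisation at the sum of two basis vectors. *)
Lemma quadratic_form_eq0 n (A : 'M[R]_n) : A^T = A ->
  (forall v : 'cV[R]_n, (v^T *m A *m v) 0 0 = 0) -> A = 0.
Proof.
move=> Asym A0; apply/matrixP => i j; rewrite mxE.
have E (k l : 'I_n) :
    ((delta_mx k 0 : 'cV[R]_n)^T *m A *m (delta_mx l 0 : 'cV[R]_n)) 0 0 = A k l.
  by rewrite trmx_delta -rowE -colE !mxE.
have := A0 (delta_mx i 0 + delta_mx j 0).
rewrite [(_ + _)^T]linearD/= !mulmxDl !mulmxDr.
have mxDE (X Y : 'M[R]_1) : (X + Y) 0 0 = X 0 0 + Y 0 0 by rewrite mxE.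
rewrite !mxDE !E.
have Aji : A j i = A i j by rewrite -[in LHS]Asym mxE.
have := A0 (delta_mx i 0); have := A0 (delta_mx j 0); rewrite !E Aji => -> ->; lra.
Qed.

(* An affine preimage of the unit ball is the centred ball of squared radius [rho]
   only for a similarity fixing the origin. *)
Lemma affine_ball_rigidity n (M : 'M[R]_n) (c : 'cV[R]_n) rho :
  0 < rho -> M \in unitmx ->
  (forall v, sqnorm (M *m v + c) <= 1 <-> sqnorm v <= rho) ->
  c = 0 /\ M^T *m M = (rho^-1)%:M.
Proof.
move=> rho0 uM EB.
have c0 : c = 0.
  apply/eqP/negPn/negP => c0; pose a := Num.sqrt (sqnorm c).
  have a0 : 0 < a by rewrite sqrtr_gt0 lt_neqAle eq_sym sqnorm_eq0 c0 sqnorm_ge0.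
  have a2 : sqnorm c = a ^+ 2 by rewrite sqr_sqrtr// sqnorm_ge0.
  (* The image [M *m p + c] is [- a^-1 *: c], a unit vector, so [p] lies in the ball, and so does
     [- p] by symmetry. But [- p] is sent to a multiple of [c] of norm [1 + 2 * a], outside the unit
     ball. *)
  pose p := invmx M *m (- (a^-1 + 1) *: c).
  have Mp : M *m p = - (a^-1 + 1) *: c by rewrite mulKVmx.
  have : sqnorm (M *m p + c) <= 1.
    rewrite Mp -[X in _ + X]scale1r -scalerDl sqnormZ a2 -exprMn.
    rewrite (_ : _ * a = -1); first by rewrite sqrrN expr1n.
    by field; rewrite gt_eqF.
  move=> /EB; rewrite -sqnormN => /EB.
  rewrite mulmxN Mp -scaleNr opprK -[X in _ + X]scale1r -scalerDl sqnormZ a2 -exprMn.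
  rewrite (_ : _ * a = 1 + 2 * a); last by field; rewrite gt_eqF.
  by rewrite leNgt exprn_egt1//; lra.
split => //; have {}EB v : sqnorm (M *m v) <= 1 <-> sqnorm v <= rho.
  by rewrite -EB c0 addr0.
have sqM v : sqnorm (M *m v) = rho^-1 * sqnorm v.
  have [->|v0] := eqVneq v 0; first by rewrite mulmx0 /sqnorm !mulmx0 !mxE mulr0.
  have sv0 : 0 < sqnorm v by rewrite lt_neqAle eq_sym sqnorm_eq0 v0 sqnorm_ge0.
  have Mv0 : 0 < sqnorm (M *m v).
    rewrite lt_neqAle eq_sym sqnorm_eq0 sqnorm_ge0 andbT.
    by apply: contra v0 => /eqP Mv0; rewrite -(mulKmx uM v) Mv0 mulmx0.
  (* One inequality comes from scaling [v] onto the sphere of squared radius [rho], the other from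
     scaling its image onto the unit sphere. *)
  apply/eqP; rewrite eq_le; apply/andP; split.
    have : sqnorm (Num.sqrt (rho / sqnorm v) *: v) <= rho.
      by rewrite sqnormZ sqr_sqrtr ?divr_ge0 ?divfK ?gt_eqF// ltW.
    move=> /EB; rewrite -scalemxAr sqnormZ sqr_sqrtr ?divr_ge0 ?(ltW rho0) ?(ltW sv0)//.
    by rewrite mulrAC ler_pdivrMr// mul1r ler_pdivlMl.
  have : sqnorm (M *m ((Num.sqrt (sqnorm (M *m v)))^-1 *: v)) <= 1.
    by rewrite -scalemxAr sqnormZ exprVn sqr_sqrtr ?(ltW Mv0) ?mulVf ?gt_eqF.
  move=> /EB; rewrite sqnormZ exprVn sqr_sqrtr ?(ltW Mv0)//.
  by rewrite !ler_pdivrMl// mulrC.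
apply/eqP; rewrite -subr_eq0; apply/eqP; apply: quadratic_form_eq0.
  by rewrite linearB/= trmx_mul trmxK tr_scalar_mx.
move=> v; have := sqM v; rewrite /sqnorm trmx_mul => MvE.
have mxBE (X Y : 'M[R]_1) : (X - Y) 0 0 = X 0 0 - Y 0 0 by rewrite !mxE.
rewrite mulmxBr mulmxBl mxBE mul_mx_scalar -scalemxAl !mulmxA in MvE *.
by rewrite MvE [X in _ - X]mxE subrr.
Qed.

End ellipsoid_rigidity.

(** * Uniqueness of the best ellipsoid and choice of the radius *)

Section optimal_ball.
Import numFieldNormedType.Exports.
Context {R : realType}.
Local Notation vol := (@lebesgue_volume R _).

Lemma measurable_sqnorm_affine m n (M : 'M[R]_(m, n)) (c : 'cV[R]_m) :
  measurable_fun setT (fun v => sqnorm (M *m v + c)).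
Proof.
apply: (measurableT_comp (@measurable_sqnorm R m)).
by apply: measurable_addmx => //; exact: measurable_mulmx.
Qed.

Lemma measurable_lt_set d (T : measurableType d) (f : T -> R) r :
  measurable_fun setT f -> measurable [set v | f v < r].
Proof.
move=> mf; rewrite -[X in measurable X]setTI.
rewrite (_ : [set v | _] = f @^-1` `]-oo, r[%classic); first exact: mf.
by apply/seteqP; split=> v /=; rewrite in_itv.
Qed.

Lemma measurable_gt_set d (T : measurableType d) (f : T -> R) r :
  measurable_fun setT f -> measurable [set v | r < f v].
Proof.
move=> mf; rewrite -[X in measurable X]setTI.
rewrite (_ : [set v | _] = f @^-1` `]r, +oo[%classic); first exact: mf.
by apply/seteqP; split=> v /=; rewrite in_itv/= andbT.
Qed.

Lemma measurable_le_set d (T : measurableType d) (f : T -> R) r :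
  measurable_fun setT f -> measurable [set v | f v <= r].
Proof.
move=> mf; rewrite -[X in measurable X]setTI.
rewrite (_ : [set v | _] = f @^-1` `]-oo, r]%classic); first exact: mf.
by apply/seteqP; split=> v /=; rewrite in_itv.
Qed.

(** Equality holds only if the two bodies differ negligibly, which must be upgraded to equality of
    sets. A point of one body outside the other can be moved slightly towards the centre of its own
    body: it becomes interior there and stays outside the other, and a whole neighbourhood would
    then have volume zero. *)
Lemma neyman_pearson_ellipsoid n rho (M : 'M[R]_n) (c : 'cV[R]_n) :
  0 < rho -> M \in unitmx ->
  let E : set 'cV[R]_n := [set v | sqnorm (M *m v + c) <= 1] in
  (gauss_measure (cball rho : set 'cV[R]_n) + (gauss_level n rho)%:E * vol E <=
   gauss_measure E + (gauss_level n rho)%:E * vol (cball rho : set 'cV[R]_n))%E ->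
  c = 0 /\ M^T *m M = (rho^-1)%:M.
Proof.
move=> rho0 uM E gf; apply: affine_ball_rigidity => // v.
pose q v := sqnorm (M *m v + c).
have cq p : q w @[w --> p] --> q p by exact: continuous_sqnorm_affine.
have cs p : sqnorm (w : 'cV[R]_n) @[w --> p] --> sqnorm p.
  have := @continuous_sqnorm_affine R n 1%:M 0 p.
  by rewrite /continuous_at; under eq_fun do rewrite mul1mx addr0; rewrite mul1mx addr0.
have mq : measurable_fun setT q by exact: measurable_sqnorm_affine.
have ms := @measurable_sqnorm R n.
have mE : measurable E by exact: measurable_le_set.
split=> [qv|sv]; rewrite leNgt; apply/negP => lt_v.
(* Moves [v] by the fraction [s] towards the centre [- (invmx M *m c)] of the ellipsoid, which
   multiplies [M *m v + c] by [1 - s]. *)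
- have [s [s0 s1]] := sqnorm_perturb (- (invmx M *m c) - v) lt_v.
  set p := _ + _ => rhop.
  pose S := [set v | q v < 1] `&` [set v | rho < sqnorm v].
  have mS : measurable S.
    by apply: measurableI; [exact: measurable_lt_set|exact: measurable_gt_set].
  have qp : q p < 1.
    have -> : q p = (1 - s) ^+ 2 * q v.
      rewrite /q -sqnormZ; congr sqnorm.
      rewrite /p mulmxDr -scalemxAr mulmxBr mulmxN mulKVmx//.
      by move: (M *m v) => u; apply/colP => i; rewrite !mxE; ring.
    rewrite (le_lt_trans (_ : _ <= (1 - s) ^+ 2 * 1)) ?ler_wpM2l ?sqr_ge0//.
    by rewrite mulr1 expr_lt1//; lra.
  apply: (nbhs_volume_neq0 (p := p) mS).
    by apply: filterI; [exact: (cvgr_lt _ (cq p))|exact: (cvgr_gt _ (cs p))].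
  apply: (neyman_pearson_eq mE mS gf) => w [qw sw]; left; split => //.
  exact: ltW.
(* Moves [v] by the fraction [s] towards the origin. *)
- have [s [s0 s1]] := sqnorm_perturb (- (M *m v)) lt_v.
  pose p := (1 - s) *: v.
  pose S := [set v | 1 < q v] `&` [set v | sqnorm v < rho].
  have mS : measurable S.
    by apply: measurableI; [exact: measurable_gt_set|exact: measurable_lt_set].
  have -> : M *m v + c + s *: (- (M *m v)) = M *m p + c.
    by rewrite /p -scalemxAr scalerBl scale1r scalerN addrAC.
  move=> qp; have sp : sqnorm p < rho.
    rewrite /p sqnormZ (le_lt_trans (_ : _ <= (1 - s) ^+ 2 * rho))//.
      by rewrite ler_wpM2l ?sqr_ge0.
    by rewrite gtr_pMl// expr_lt1//; lra.
  apply: (nbhs_volume_neq0 (p := p) mS).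
    by apply: filterI; [exact: (cvgr_gt _ (cq p))|exact: (cvgr_lt _ (cs p))].
  apply: (neyman_pearson_eq mE mS gf) => w [qw sw]; right; split => //.
  by rewrite /E/=; apply/negP; rewrite -ltNge.
Qed.

Lemma vol_cball n s : 0 < s ->
  vol (cball (s ^+ 2) : set 'cV[R]_n) = ((s ^+ n)%:E * vol (cball 1 : set 'cV[R]_n))%E.
Proof.
move=> s0; have [_ sP] := @volume_scaling_scalar R n s s0.
rewrite -(sP (cball (s ^+ 2)) 0)//; last exact: measurable_cball.
rewrite det_scalar; congr (_ * vol _)%E.
apply/seteqP; split=> v /=; rewrite /cball/= mul_scalar_mx addr0 sqnormZ;
  by rewrite ger_pMr// exprn_gt0.
Qed.

Lemma gauss_measure_le_vol n (A : set 'cV[R]_n) : measurable A ->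
  (gauss_measure A <= (normal_peak 1 ^+ n)%:E * vol A)%E.
Proof.
move=> mA; rewrite -integral_cst//; apply: ge0_le_integral => //.
- by move=> v _; rewrite lee_fin gauss_pdf_ge0.
- by apply: measurable_funTS; apply/measurable_EFinP; exact: measurable_gauss_pdf.
- move=> v _; rewrite lee_fin /gauss_pdf ger_pMr ?exprn_gt0 ?normal_peak_gt0//.
  by rewrite -expR0 ler_expR oppr_le0 divr_ge0// sqnorm_ge0.
Qed.

(** Intermediate values for the mass [G] as a function of the radius [s]. It is continuous because a
    shell has mass at most the peak density times its volume, which is proportional to
    [s' ^+ n - s ^+ n]. *)
Lemma cball_quantile n (eta : R) : (0 < n)%N -> 0 < eta -> eta < 1 ->
  exists2 rho, 0 < rho & gauss_measure (cball rho : set 'cV[R]_n) = eta%:E.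
Proof.
move=> n0 eta0 eta1.
pose G s := fine (gauss_measure (cball (s ^+ 2) : set 'cV[R]_n)).
have GE s : gauss_measure (cball (s ^+ 2) : set 'cV[R]_n) = (G s)%:E.
  by rewrite fineK// fin_num_measure//; exact: measurable_cball.
pose c := fine (vol (cball 1 : set 'cV[R]_n)).
have cE : vol (cball 1 : set 'cV[R]_n) = c%:E.
  by rewrite fineK// ge0_fin_numE// vol_cball_fin.
have c0 : 0 <= c by rewrite -lee_fin -cE.
pose C := normal_peak 1 ^+ n * c : R.
have C0 : 0 <= C by rewrite mulr_ge0// exprn_ge0// normal_peak_ge0.
have mcball s : measurable (cball s : set 'cV[R]_n) by exact: measurable_cball.
have cballS s s' : 0 <= s -> s <= s' ->
    (cball (s ^+ 2) : set 'cV[R]_n) `<=` cball (s' ^+ 2).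
  move=> s0 ss' v; rewrite /cball/= => /le_trans; apply.
  by rewrite ler_pXn2r ?nnegrE// (le_trans s0).
have Gmono s s' : 0 <= s -> s <= s' -> G s <= G s'.
  by move=> s0 ss'; rewrite -lee_fin -!GE le_measure ?inE//; exact: cballS.
have Glip s s' : 0 < s -> s <= s' -> G s' - G s <= C * s' ^+ n - C * s ^+ n.
  move=> s0 ss'; have s'0 := lt_le_trans s0 ss'.
  have sub := cballS s s' (ltW s0) ss'.
  have mD : measurable ((cball (s' ^+ 2) : set 'cV[R]_n) `\` cball (s ^+ 2)).
    exact: measurableD.
  have gD : gauss_measure ((cball (s' ^+ 2) : set 'cV[R]_n) `\` cball (s ^+ 2)) =
      (G s' - G s)%:E.
    have goo : (gauss_measure (cball (s' ^+ 2) : set 'cV[R]_n) < +oo)%E.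
      by rewrite GE ltry.
    apply: etrans (measureD (mcball _) (mcball _) goo) _.
    by rewrite (setIidr sub) EFinB; congr (_ - _)%E; exact: GE.
  have vD : vol ((cball (s' ^+ 2) : set 'cV[R]_n) `\` cball (s ^+ 2)) =
      (s' ^+ n * c - s ^+ n * c)%:E.
    apply: etrans (measureD (mcball _) (mcball _) (vol_cball_fin _ _)) _.
    rewrite (setIidr sub) EFinB; congr (_ - _)%E.
      by apply: etrans (vol_cball n s'0) _; rewrite cE.
    by apply: etrans (vol_cball n s0) _; rewrite cE.
  have := gauss_measure_le_vol mD.
  rewrite gD vD -EFinM lee_fin => /le_trans; apply.
  by rewrite -!mulrBl mulrCA mulrC -mulrBr.
have Glip0 s : 0 < s -> G s <= C * s ^+ n.
  move=> s0; have := gauss_measure_le_vol (mcball (s ^+ 2)).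
  by rewrite GE vol_cball// cE -!EFinM lee_fin mulrCA mulrC.
have Gcont s : 0 < s -> {for s, continuous G}.
  move=> s0; apply/cvgrPdist_le => e e0.
  have /cvgrPdist_le cC : C * (t : R) ^+ n @[t --> s] --> C * s ^+ n.
    by apply: cvgM; [exact: cvg_cst|exact: exprn_continuous].
  near=> t.
  have t0 : 0 < t by near: t; exact: lt_nbhsr.
  have : `|C * s ^+ n - C * t ^+ n| <= e.
    by near: t; exact: cC.
  have [st|/ltW ts] := leP s t.
    rewrite distrC => Ce; rewrite distrC ger0_norm ?subr_ge0 ?Gmono ?(ltW s0)//.
    exact: le_trans (Glip _ _ s0 st) (le_trans (ler_norm _) Ce).
  move=> Ce; rewrite ger0_norm ?subr_ge0 ?Gmono ?(ltW t0)//.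
  exact: le_trans (Glip _ _ t0 ts) (le_trans (ler_norm _) Ce).
(* Balls of integer radius exhaust the space, whose mass 1 exceeds [eta]. *)
have [k Gk] : exists k : nat, eta <= G k%:R.
  apply: contrapT => /forallNP Gk.
  pose F (k : nat) : set 'cV[R]_n := cball (k%:R ^+ 2).
  have cF : gauss_measure (F k) @[k --> \oo] --> gauss_measure (\bigcup_k F k).
    apply: nondecreasing_cvg_mu.
    - by move=> k; exact: mcball.
    - by apply: bigcupT_measurable => k; exact: mcball.
    - by move=> k l kl; apply/subsetPset; apply: cballS; rewrite ?ler0n ?ler_nat.
  have FT : \bigcup_k F k = setT.
    apply/seteqP; split => // v _; exists (Num.truncn (sqnorm v)).+1 => //.
    rewrite /F /cball/= (le_trans (ltW (truncnS_gt _)))//.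
    by rewrite expr2 ler_peMl// ler1n.
  have : (gauss_measure [set: 'cV[R]_n] <= eta%:E)%E.
    rewrite -FT; apply: (cvge_le _ cF).
    by apply: nearW => k; rewrite /F GE lee_fin leNgt; apply/negP => /ltW /Gk.
  by rewrite probability_setT lee_fin leNgt eta1.
(* From [0 < n] and [s0 <= 1] follows [C * s0 ^+ n <= C * s0], which is at most [eta]. *)
pose s0 := Num.min 1 (eta / (C + 1)).
have s00 : 0 < s0 by rewrite lt_min ltr01 divr_gt0// ltr_pwDr.
have Gs0 : G s0 <= eta.
  rewrite (le_trans (Glip0 _ s00))// (le_trans (_ : _ <= C * s0))//.
    have s01 : s0 <= 1 by rewrite ge_min lexx.
    rewrite ler_wpM2l// -(prednK n0) exprS.
    by rewrite ler_piMr ?(ltW s00)// exprn_ile1 ?(ltW s00).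
  rewrite (le_trans (_ : _ <= C * (eta / (C + 1))))//.
    by rewrite ler_wpM2l// ge_min lexx orbT.
  by rewrite mulrCA ler_piMr ?(ltW eta0)// ler_pdivrMr ?ltr_pwDr// mul1r lerDl.
pose K := Num.max s0 k%:R.
have s0K : s0 <= K by rewrite le_max lexx.
have GK : eta <= G K by rewrite (le_trans Gk)// Gmono// le_max lexx orbT.
have [s] : exists2 s, s \in `[s0, K] & G s = eta.
  apply: IVT => //.
    apply: continuous_in_subspaceT => s; rewrite inE/= in_itv/= => /andP[s0s _].
    by apply: Gcont; exact: lt_le_trans s0s.
  by rewrite ge_min le_max Gs0 GK orbT.
rewrite in_itv/= => /andP[s0s _] Gs; exists (s ^+ 2).
  by rewrite exprn_gt0// (lt_le_trans s00).
by rewrite GE Gs.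
Unshelve. all: by end_near. Qed.

End optimal_ball.

(** * Gaussian regression *)

Section orthonormal_bases.
Context {R : realType}.

Lemma gram_posdef m n (N : 'M[R]_(m, n)) :
  (forall v : 'cV[R]_m, v != 0 -> N^T *m v != 0) -> posdefmx (N *m N^T).
Proof.
move=> N0; split; first by rewrite trmx_mul trmxK.
move=> v /N0 Nv0; rewrite mulmxA -mulmxA.
rewrite (_ : v^T *m N = (N^T *m v)^T); last by rewrite trmx_mul trmxK.
by rewrite -/(sqnorm _) lt_neqAle eq_sym sqnorm_eq0 Nv0 sqnorm_ge0.
Qed.

Lemma row_free_trmx_mul m n (N : 'M[R]_(m, n)) (v : 'cV[R]_m) :
  row_free N -> v != 0 -> N^T *m v != 0.
Proof.
move=> /row_freeP [M NM]; apply: contra => /eqP Nv0.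
rewrite -[v]mul1mx -trmx1 -NM trmx_mul -mulmxA Nv0 mulmx0; exact: eqxx.
Qed.

(** Gram-Schmidt by Cholesky: if [T *m T^T] is the Gram matrix of a row basis, then [invmx T] makes
    that basis orthonormal. *)
Lemma orthonormal_row_basis m n (A : 'M[R]_(m, n)) :
  exists Q : 'M[R]_(\rank A, n), Q *m Q^T = 1%:M /\ (Q :=: A)%MS.
Proof.
have [T [volT TT]] := posdef_cholesky (gram_posdef
  (fun v v0 => row_free_trmx_mul (row_base_free A) v0)).
have uT := volume_scaling_unitmx volT.
exists (invmx T *m row_base A); split.
  rewrite trmx_mul mulmxA -(mulmxA (invmx T)) -TT mulKmx// trmx_inv.
  by rewrite mulmxV// unitmx_tr.
apply: (eqmx_trans (eqmxMfull _ _) (eq_row_base A)).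
by rewrite row_full_unit unitmx_inv.
Qed.

(** The rows of [kermx Q^T] span the orthogonal complement of the row space of [Q]. The order
    [r + n] matches the stacking [col_mx Q' Q]. *)
Lemma orthonormal_completion n k (Q : 'M[R]_(n, k)) : Q *m Q^T = 1%:M ->
  exists r (Q' : 'M[R]_(r, k)),
    [/\ (r + n)%N = k, Q' *m Q'^T = 1%:M & Q' *m Q^T = 0].
Proof.
move=> QQ; have [Q' [Q'Q' Q'E]] := orthonormal_row_basis (kermx Q^T).
exists (\rank (kermx Q^T)), Q'; split => //.
  have rQ : \rank Q = n by apply/eqP/row_freeP; exists Q^T.
  by rewrite mxrank_ker mxrank_tr rQ subnK// -[in leqLHS]rQ rank_leq_col.
by apply/sub_kermxP; rewrite Q'E.
Qed.

End orthonormal_bases.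

(** * Entrywise integrals, conditional expectations and laws *)

Section matrix_integral.
Context d (T : measurableType d) (R : realType) (mu : {measure set T -> \bar R}).

Lemma ae_eq_integrable (f g : T -> \bar R) : measurable_fun setT g ->
  mu.-integrable setT f -> ae_eq mu setT f g -> mu.-integrable setT g.
Proof.
move=> mg iF fg; apply/integrableP; split => //.
have /integrableP[mf foo] := iF.
rewrite -(@ae_eq_integral _ _ _ mu setT (fun w => `|g w|)%E (fun w => `|f w|)%E) //.
- exact: measurableT_comp.
- exact: measurableT_comp.
- exact: ae_eq_abse.
Qed.

Definition mx_integrable m n (F : T -> 'M[R]_(m, n)) : Prop :=
  forall i j, mu.-integrable setT (fun w => (F w i j)%:E).

Definition int_mx m n (F : T -> 'M[R]_(m, n)) : 'M[R]_(m, n) :=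
  \matrix_(i, j) fine (\int[mu]_w (F w i j)%:E)%E.

Lemma mx_integrableMl p m n (A : 'M[R]_(p, m)) (F : T -> 'M[R]_(m, n)) :
  mx_integrable F -> mx_integrable (fun w => A *m F w).
Proof.
move=> iF i j.
apply: (eq_integrable measurableT (fun w => \sum_k (A i k)%:E * (F w k j)%:E)%E).
  by move=> w _; rewrite mxE -sumEFin.
by apply: integrable_sum => // k _; apply: integrableZl.
Qed.

Lemma int_mxMl p m n (A : 'M[R]_(p, m)) (F : T -> 'M[R]_(m, n)) :
  mx_integrable F -> int_mx (fun w => A *m F w) = A *m int_mx F.
Proof.
move=> iF; apply/matrixP => i j; rewrite !mxE.
transitivity (fine (\int[mu]_w \sum_k (A i k)%:E * (F w k j)%:E)%E).
  by congr fine; apply: eq_integral => w _; rewrite mxE -sumEFin.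
rewrite integral_sum//; last by move=> k; exact: integrableZl.
rewrite -sum_fine; last first.
  by move=> k _; apply: integrable_fin_num => //; exact: integrableZl.
apply: eq_bigr => k _; rewrite integralZl// fineM ?mxE//.
exact: integrable_fin_num.
Qed.

Lemma mx_integrable_tr m n (F : T -> 'M[R]_(m, n)) :
  mx_integrable F -> mx_integrable (fun w => (F w)^T).
Proof. by move=> iF i j; under eq_fun do rewrite mxE; exact: iF. Qed.

Lemma int_mx_tr m n (F : T -> 'M[R]_(m, n)) :
  int_mx (fun w => (F w)^T) = (int_mx F)^T.
Proof.
apply/matrixP => i j; rewrite !mxE; congr fine.
by apply: eq_integral => w _; rewrite mxE.
Qed.

Lemma mx_integrableMr m n p (A : 'M[R]_(n, p)) (F : T -> 'M[R]_(m, n)) :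
  mx_integrable F -> mx_integrable (fun w => F w *m A).
Proof.
move=> /mx_integrable_tr/(mx_integrableMl A^T)/mx_integrable_tr.
by under eq_fun do rewrite trmx_mul !trmxK.
Qed.

Lemma int_mxMr m n p (A : 'M[R]_(n, p)) (F : T -> 'M[R]_(m, n)) :
  mx_integrable F -> int_mx (fun w => F w *m A) = int_mx F *m A.
Proof.
move=> /mx_integrable_tr iF; apply: trmx_inj.
rewrite -int_mx_tr trmx_mul -int_mx_tr -int_mxMl//.
by under eq_fun do rewrite trmx_mul.
Qed.

Lemma eq_ae_mx_integrable m n (F G : T -> 'M[R]_(m, n)) :
  measurable_fun setT G -> mx_integrable F ->
  {ae mu, forall w, F w = G w} -> mx_integrable G /\ int_mx F = int_mx G.
Proof.
move=> /measurable_mxP mG iF FG.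
have mGE i j : measurable_fun setT (fun w => (G w i j)%:E).
  exact/measurable_EFinP/mG.
have FGE i j : ae_eq mu setT (fun w => (F w i j)%:E) (fun w => (G w i j)%:E).
  by apply: filterS FG => w -> _.
split; last first.
  apply/matrixP => i j; rewrite !mxE; congr fine; apply: ae_eq_integral => //.
  exact: measurable_int (iF i j).
by move=> i j; exact: ae_eq_integrable (iF i j) (FGE i j).
Qed.

End matrix_integral.

Section conditional_expectation_unique.
Context {disp : measure_display} {Omega : measurableType disp} {R : realType}.
Variable P : probability Omega R.

(** Both versions have the same integrals over every measurable set for the law of [x], hence agree
    outside a null set of that law, which is pulled back along [x]. *)
Lemma cond_expectation_unique d (x : {RV P >-> 'cV[R]_d}) f g g' :
  is_cond_expectation x f g -> is_cond_expectation x f g' ->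
  {ae P, forall w, g (x w) = g' (x w)}.
Proof.
move=> [_ mg ig gE] [_ mg' ig' g'E].
have mx : measurable_fun setT x by [].
have mgE : measurable_fun setT (EFin \o g) by exact/measurable_EFinP.
have mgE' : measurable_fun setT (EFin \o g') by exact/measurable_EFinP.
have igE : (distribution P x).-integrable setT (EFin \o g).
  by apply: integrable_pushforward.
have gg' E : E `<=` setT -> measurable E ->
    (\int[distribution P x]_(u in E) (EFin \o g) u =
     \int[distribution P x]_(u in E) (EFin \o g') u)%E.
  move=> _ mE; rewrite !integral_pushforward//.
  - by rewrite gE// g'E.
  - by apply: integrableS ig' => //; rewrite -[X in measurable X]setTI; exact: mx.
  - by apply: integrableS ig => //; rewrite -[X in measurable X]setTI; exact: mx.
have [N [mN N0 sub]] := integral_ae_eq measurableT igE mgE' gg'.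
exists (x @^-1` N); split => //.
  by rewrite -[X in measurable X]setTI; exact: mx.
by move=> w /= gw; apply: sub => /= /(_ I) [].
Qed.

End conditional_expectation_unique.

Section gauss_measure_product.
Context {R : realType}.

Lemma measurable_uncurry_col_mx r n : measurable_fun setT
  (fun p : 'cV[R]_r * 'cV[R]_n => col_mx p.1 p.2).
Proof. by apply: measurable_col_mx. Qed.

(** This is independence of two blocks, checked on boxes, where both sides are the same product of
    one-dimensional probabilities. *)
Lemma gauss_measure_col_mx r n (A : set 'cV[R]_(r + n)) : measurable A ->
  gauss_measure A =
  (@gauss_measure R r \x @gauss_measure R n)%E
    [set p | A (col_mx p.1 p.2)].
Proof.
move=> mA.
pose nu := image_measure
  (@gauss_measure R r \x @gauss_measure R n)%E (@measurable_uncurry_col_mx r n).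
apply: (@box_measure_unique R _ (@gauss_measure R (r + n)) nu) => //.
  by apply: le_lt_trans (probability_le1 _ _) _ => //; exact: ltry.
move=> B mB; apply: etrans (gauss_measure_box mB) _; rewrite big_split_ord/=.
rewrite -!gauss_measure_box// -product_measure1E//; try exact: measurable_box.
congr (product_measure1 _ _ _).
apply/seteqP; split => -[u v]; rewrite /box/=.
  move=> [Bu Bv] i; rewrite mxE; case: splitP => j ij.
    by have := Bu j; congr (B _ _); apply/val_inj.
  by have := Bv j; congr (B _ _); apply/val_inj.
move=> Buv; split => i; first by have := Buv (lshift n i); rewrite col_mxEu.
by have := Buv (rshift r i); rewrite col_mxEd.
Qed.

End gauss_measure_product.

Section equal_laws.
Context d1 d2 (T : measurableType d1) (Y : measurableType d2) (R : realType).
Variables (mu : {measure set T -> \bar R}) (phi1 phi2 : T -> Y).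
Hypotheses (mphi1 : measurable_fun setT phi1) (mphi2 : measurable_fun setT phi2).
Hypothesis phi12 : forall A, measurable A -> mu (phi1 @^-1` A) = mu (phi2 @^-1` A).

Let nu := image_measure mu mphi1.

Lemma integral_eq_law (f : Y -> \bar R) : measurable_fun setT f ->
  mu.-integrable setT (f \o phi1) ->
  mu.-integrable setT (f \o phi2) /\
  (\int[mu]_x f (phi1 x) = \int[mu]_x f (phi2 x))%E.
Proof.
move=> mf if1.
have if2 : mu.-integrable setT (f \o phi2).
  apply/integrableP; split; first exact: measurableT_comp.
  move/integrableP: if1 => [_]; congr (_ < _)%E.
  have mf' : measurable_fun setT (fun y => `|f y|)%E by exact: measurableT_comp.
  rewrite -(@ge0_integral_image _ _ _ _ _ mu nu _ mphi1 _ _ mf')//.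
  exact: (@ge0_integral_image _ _ _ _ _ mu nu _ mphi2 phi12).
split => //.
rewrite -(@integral_image _ _ _ _ _ mu nu _ mphi1 _ _ mf)//.
exact: (@integral_image _ _ _ _ _ mu nu _ mphi2 phi12).
Qed.

End equal_laws.

Section regression_matrices.
Context {R : realType}.

(* [N] is the part of [A2] orthogonal to the rows of [A1]; the reflection [H]
   fixes the rows of [A1] and negates those of [N]. *)
Lemma regression_matrices d n k (A1 : 'M[R]_(d, k)) (A2 : 'M[R]_(n, k)) :
  exists (K : 'M[R]_(n, d)) (N : 'M[R]_(n, k)) (H : 'M[R]_k),
    [/\ A2 = K *m A1 + N, A1 *m N^T = 0, H^T *m H = 1%:M,
        A1 *m H = A1 & N *m H = - N].
Proof.
have [Q [QQ QA]] := orthonormal_row_basis A1.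
have /submxP[E QE] : (Q <= A1)%MS by rewrite QA.
have /submxP[F AF] : (A1 <= Q)%MS by rewrite QA.
(* [Pi] is the orthogonal projection onto the row space of [A1], and [H] below is the reflection
   [2 Pi - 1]. *)
pose Pi := Q^T *m Q.
have PiPi : Pi *m Pi = Pi by rewrite /Pi mulmxA -(mulmxA Q^T) QQ mulmx1.
have PiT : Pi^T = Pi by rewrite /Pi trmx_mul trmxK.
have A1Pi : A1 *m Pi = A1 by rewrite {1}AF /Pi mulmxA -(mulmxA F) QQ mulmx1 -AF.
pose H : 'M[R]_k := Pi + Pi - 1%:M.
have HT : H^T = H by rewrite /H [LHS]linearB/= [X in X - _]linearD/= PiT trmx1.
have HPi : H *m Pi = Pi by rewrite mulmxBl mulmxDl PiPi mul1mx addrK.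
(* As [Q = E *m A1], the first matrix times [A1] is [A2 *m Pi]. It is a regression coefficient even
   when the covariance of [x] is singular. *)
exists (A2 *m Q^T *m E), (A2 - A2 *m Pi), H.
have NPi : (A2 - A2 *m Pi) *m Pi = 0 by rewrite mulmxBl -mulmxA PiPi subrr.
split.
- by rewrite -(mulmxA _ E) -QE -mulmxA addrC subrK.
- by rewrite -[in LHS]A1Pi -mulmxA -[X in X *m _^T]PiT -trmx_mul NPi trmx0 mulmx0.
- by rewrite HT {2}/H mulmxBr mulmxDr HPi mulmx1 opprB addrCA subrr addr0.
- by rewrite mulmxBr mulmxDr A1Pi mulmx1 addrK.
- by rewrite mulmxBr mulmxDr NPi addr0 sub0r mulmx1.
Qed.

End regression_matrices.

Section int_mx_posdef.
Context {disp : measure_display} {Omega : measurableType disp} {R : realType}.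
Variable P : probability Omega R.

Lemma probability_integral_gt0 (f : Omega -> \bar R) :
  measurable_fun setT f -> (forall w, 0 <= f w)%E ->
  {ae P, forall w, 0 < f w}%E -> (0 < \int[P]_w f w)%E.
Proof.
move=> mf f0 fpos; rewrite lt0e integral_ge0// andbT; apply/eqP => If.
have If' : (\int[P]_w `|f w| = 0)%E by under eq_integral do rewrite gee0_abs//.
have f00 := (ae_eq_integral_abs P measurableT mf).1 If'.
have [N [mN N0 sub]] : {ae P, forall w : Omega, False}.
  by apply: filterS2 fpos f00 => w fw /(_ I)/= fw0; rewrite fw0 ltxx in fw.
have : (P setT <= P N)%E.
  by apply: le_measure; rewrite ?inE// => w _; apply: sub => -[].
by rewrite N0 probability_setT lee_fin ler10.
Qed.

Lemma int_mx_posdef n (F : Omega -> 'M[R]_n) :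
  mx_integrable P F -> {ae P, forall w, posdefmx (F w)} -> posdefmx (int_mx P F).
Proof.
move=> iF pF; split.
  rewrite -int_mx_tr.
  have mF : measurable_fun setT F.
    apply/measurable_mxP => i j; apply/measurable_EFinP.
    exact: measurable_int (iF i j).
  have [|_ ->//] := eq_ae_mx_integrable mF (mx_integrable_tr iF).
  by apply: filterS pF => w [].
move=> v v0; rewrite -int_mxMl// -int_mxMr; last exact: mx_integrableMl.
have iq := mx_integrableMr v (mx_integrableMl v^T iF) 0 0.
rewrite mxE.
have q0 : {ae P, forall w, (0 < (v^T *m F w *m v) 0 0)}.
  by apply: filterS pF => w [_]; exact.
have mq := measurable_int _ iq.
have qE : (\int[P]_w ((v^T *m F w *m v) 0 0)%:E =
    \int[P]_w `|((v^T *m F w *m v) 0 0)%:E|)%E.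
  apply: ae_eq_integral => //; first exact: measurableT_comp.
  by apply: filterS q0 => w qw _ /=; rewrite ger0_norm// ltW.
have q_gt0 : (0 < \int[P]_w ((v^T *m F w *m v) 0 0)%:E)%E.
  rewrite qE; apply: probability_integral_gt0 => //; first exact: measurableT_comp.
  by apply: filterS q0 => w qw; rewrite lte_fin normr_gt0 gt_eqF.
by rewrite fine_gt0// q_gt0 integrable_lty.
Qed.

End int_mx_posdef.

(** * The conditional mean as an affine function *)

Section gaussian_regression.
Context {disp : measure_display} {Omega : measurableType disp} {R : realType}.
Variable P : probability Omega R.

Lemma measurable_affine d (T : measurableType d) m n (A : 'M[R]_(m, n)) b
    (f : T -> 'cV[R]_n) :
  measurable_fun setT f -> measurable_fun setT (fun w => A *m f w + b).
Proof. by move=> mf; apply: measurable_addmx => //; exact: measurable_mulmx. Qed.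

Lemma ae_eq_probability (A B : set Omega) : measurable A -> measurable B ->
  {ae P, forall w, A w <-> B w} -> P A = P B.
Proof.
move=> mA mB AB; rewrite -[A]setIT -[B]setIT -!integral_indic//.
apply: ae_eq_integral => //; try exact/measurable_EFinP/measurable_indic.
apply: filterS AB => w AB _ /=; rewrite !indicE; congr (_%:R%:E).
by congr (nat_of_bool _); apply/idP/idP; rewrite !inE => /AB.
Qed.

Section cond_mean.
Variables (d n k : nat) (A1 : 'M[R]_(d, k)) (A2 : 'M[R]_(n, k)).
Variables (b1 : 'cV[R]_d) (b2 : 'cV[R]_n) (Z : {RV P >-> 'cV[R]_k}).
Variables (x : {RV P >-> 'cV[R]_d}) (y : {RV P >-> 'cV[R]_n}).
Hypothesis Zstd : standard_gaussian Z.
Hypothesis xE : {ae P, forall w, x w = A1 *m Z w + b1}.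
Hypothesis yE : {ae P, forall w, y w = A2 *m Z w + b2}.
Variables (K : 'M[R]_(n, d)) (N : 'M[R]_(n, k)) (H : 'M[R]_k).
Hypotheses (A2E : A2 = K *m A1 + N) (HH : H^T *m H = 1%:M).
Hypotheses (A1H : A1 *m H = A1) (NH : N *m H = - N).

Let mZ : measurable_fun setT Z. Proof. by []. Qed.
Let mx : measurable_fun setT x. Proof. by []. Qed.

Let mHZ : measurable_fun setT (fun w => H *m Z w).
Proof. exact: measurable_mulmx. Qed.

Let reg u : 'cV[R]_n := K *m (u - b1) + b2.

Let measurable_reg : measurable_fun setT reg.
Proof. by apply: measurable_affine; exact: measurable_submx. Qed.

(** Averaging over [z] and [H *m z] cancels the residual [N *m z] and keeps [A1 *m z]. *)
Let reg_symm z : reg (A1 *m z + b1) =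
  2^-1 *: ((A2 *m z + b2) + (A2 *m (H *m z) + b2)).
Proof.
have A2H : A2 *m H = K *m A1 - N by rewrite A2E mulmxDl -mulmxA A1H NH.
rewrite /reg addrK mulmxA [A2 *m (H *m z)]mulmxA A2H A2E mulmxDl mulmxBl.
move: (K *m A1 *m z) (N *m z) => p q.
by apply/colP => i; rewrite !mxE; field.
Qed.

(* The reflection [H] leaves the law of [Z] and the value of [x] unchanged but negates
   the residual [N Z], whose integral over any event [x \in B] therefore vanishes. *)
Lemma cond_expectation_regression i :
  P.-integrable setT (fun w => (y w i 0)%:E) ->
  is_cond_expectation x (fun w => y w i 0) (fun u => reg u i 0).
Proof.
move=> iy.
(* The integrand on the event [x \in B] is written as a function of [Z] alone, so that the equality
   in law of [Z] and [H *m Z] applies to it. *)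
pose Phi B z : \bar R := ((A2 *m z + b2) i 0 * \1_B (A1 *m z + b1))%:E.
have mPhi B : measurable B -> measurable_fun setT (Phi B).
  move=> mB; apply/measurable_EFinP; apply: measurable_funM.
    apply: (measurableT_comp (measurable_mx_entry i 0)).
    exact: measurable_affine.
  apply: (measurableT_comp (measurable_indic mB)).
  exact: measurable_affine.
have mxB B : measurable B -> measurable (x @^-1` B).
  by move=> mB; rewrite -[X in measurable X]setTI; exact: mx.
have mxind B : measurable B -> measurable_fun setT (fun w => \1_B (x w) : R).
  by move=> mB; apply: (measurableT_comp (measurable_indic mB)).
have mregx : measurable_fun setT (fun w => reg (x w) i 0).
  apply: (measurableT_comp (measurable_mx_entry i 0)).
  exact: (measurableT_comp measurable_reg).
have myi : measurable_fun setT (fun w => y w i 0).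
  by apply: (measurableT_comp (measurable_mx_entry i 0)).
have int_on B (f : Omega -> R) : measurable B ->
    (\int[P]_(w in x @^-1` B) (f w)%:E = \int[P]_w (f w * \1_B (x w))%:E)%E.
  move=> mB; rewrite integral_mkcond; apply: eq_integral => w _.
  rewrite patchE indicE; have [/[!inE] Bx|Bx] := boolP (w \in x @^-1` B).
    by rewrite mem_set// mulr1.
  by rewrite memNset ?mulr0// => xB; move/negP: Bx; apply; rewrite inE.
have iPhi B : measurable B -> P.-integrable setT (Phi B \o Z).
  move=> mB; apply: (@ae_eq_integrable _ _ _ P (fun w => (y w i 0 * \1_B (x w))%:E)).
  - by apply: measurableT_comp => //; exact: mPhi.
  - apply: (le_integrable measurableT _ _ iy).
      by apply/measurable_EFinP; apply: measurable_funM => //; exact: mxind.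
    move=> w _; rewrite /= lee_fin normrM ler_piMr// indicE.
    by case: (_ \in _); rewrite ?normr1 ?normr0.
  - by apply: filterS2 xE yE => w /= -> -> _.
have iPhiH B : measurable B -> P.-integrable setT (fun w => Phi B (H *m Z w)) /\
    (\int[P]_w Phi B (Z w) = \int[P]_w Phi B (H *m Z w))%E.
  move=> mB; apply: (integral_eq_law mZ mHZ); [|exact: mPhi|exact: iPhi].
  move=> A mA; apply/esym.
  exact: (standard_gaussian_orthogonal Zstd HH).
have key : forall B, measurable B ->
  {ae P, forall w, (reg (x w) i 0 * \1_B (x w))%:E =
    (2^-1%:E * (Phi B (Z w) + Phi B (H *m Z w)))%E}.
  move=> B mB; apply: filterS xE => w ->.
  by rewrite reg_symm /Phi !mulmxA A1H !mxE -EFinD -EFinM; congr EFin; ring.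
have isum B : measurable B ->
    P.-integrable setT (fun w => 2^-1%:E * (Phi B (Z w) + Phi B (H *m Z w)))%E.
  move=> mB; apply: integrableZl => //; apply: integrableD => //.
    exact: iPhi.
  exact: (iPhiH B mB).1.
split => //.
- apply: (measurableT_comp (measurable_mx_entry i 0)); exact: measurable_reg.
- apply: ae_eq_integrable (isum _ measurableT) _.
    exact/measurable_EFinP.
  by apply: filterS (key _ measurableT) => w /= <- _; rewrite indicE in_setT mulr1.
move=> B mB; rewrite !int_on//.
transitivity (\int[P]_w (2^-1%:E * (Phi B (Z w) + Phi B (H *m Z w))))%E.
  apply: ae_eq_integral => //.
  - by apply/measurable_EFinP; apply: measurable_funM => //; exact: mxind.
  - exact: measurable_int (isum B mB).
  - by apply: filterS (key B mB) => w + _.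
have [iPH PhiE] := iPhiH B mB.
rewrite integralZl//; last by apply: integrableD => //; exact: iPhi.
rewrite integralD//; last exact: iPhi.
rewrite -PhiE.
transitivity (\int[P]_w Phi B (Z w))%E.
  have : (\int[P]_w Phi B (Z w))%E \is a fin_num.
    by apply: integrable_fin_num => //; exact: iPhi.
  by move=> /fineK <-; rewrite -EFinD -EFinM; congr EFin; field.
apply: ae_eq_integral => //; first exact: measurable_int (iPhi B mB).
  by apply/measurable_EFinP; apply: measurable_funM => //; exact: mxind.
by apply: filterS2 xE yE => w -> -> _.
Qed.

End cond_mean.
End gaussian_regression.

(** * The independent standard residual *)

Section independent_residual.
Context {disp : measure_display} {Omega : measurableType disp} {R : realType}.
Variable P : probability Omega R.

(** [U *m Z] is again standard, so its two blocks are independent. Integrating out the second block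
    leaves the measure of a section, and the law of the first block carries the outer integral back
    to [P]. *)
Lemma gaussian_block_law r n (Z : {RV P >-> 'cV[R]_(r + n)}) (U : 'M[R]_(r + n))
    d (g : 'cV[R]_r -> 'cV[R]_d) (D : set ('cV[R]_d * 'cV[R]_n)) :
  standard_gaussian Z -> U^T *m U = 1%:M -> measurable_fun setT g -> measurable D ->
  P [set w | D (g (usubmx (U *m Z w)), dsubmx (U *m Z w))] =
  (\int[P]_w gauss_measure (xsection D (g (usubmx (U *m Z w)))))%E.
Proof.
move=> Zstd UU mg mD.
have mus : measurable_fun setT (fun z : 'cV[R]_(r + n) => usubmx z).
  apply/measurable_mxP => i j; under eq_fun do rewrite mxE.
  exact: measurable_mx_entry.
have mds : measurable_fun setT (fun z : 'cV[R]_(r + n) => dsubmx z).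
  apply/measurable_mxP => i j; under eq_fun do rewrite mxE.
  exact: measurable_mx_entry.
have law (A : set 'cV[R]_(r + n)) : measurable A -> P [set w | A (U *m Z w)] =
    (@gauss_measure R r \x @gauss_measure R n)%E [set p | A (col_mx p.1 p.2)].
  move=> mA; rewrite (standard_gaussian_orthogonal Zstd UU mA).
  by rewrite -gauss_measure_col_mx// -(standard_gaussian_law Zstd mA).
have mV : measurable_fun setT (fun w => usubmx (U *m Z w)).
  by apply: (measurableT_comp mus); exact: measurable_mulmx.
have Vlaw E : measurable E ->
    gauss_measure E = P ((fun w => usubmx (U *m Z w)) @^-1` E).
  move=> mE; rewrite (law [set z | E (usubmx z)]); last first.
    by rewrite -[X in measurable X]setTI; exact: mus.
  rewrite (_ : [set p | _] = E `*` setT); last first.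
    by apply/seteqP; split=> -[u v] /=; rewrite col_mxKu => //; case.
  rewrite -[LHS]mule1 -(probability_setT (@gauss_measure R n)).
  by apply/esym; exact: product_measure1E.
have mDg : measurable [set z : 'cV[R]_(r + n) | D (g (usubmx z), dsubmx z)].
  rewrite -[X in measurable X]setTI.
  apply: (_ : measurable_fun setT
    (fun z : 'cV[R]_(r + n) => (g (usubmx z), dsubmx z))) => //.
  by apply: measurable_fun_pair => //; exact: measurableT_comp.
rewrite (law [set z | D (g (usubmx z), dsubmx z)])//.
rewrite -(@ge0_integral_image _ _ _ _ _ P (@gauss_measure R r) _ mV Vlaw
  (fun v => gauss_measure (xsection D (g v))))//; last first.
  exact: measurableT_comp (measurable_fun_xsection _ mD) mg.
apply: eq_integral => v _ /=; congr (gauss_measure _).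
by apply/seteqP; split=> w; rewrite /xsection/= !inE/= col_mxKu col_mxKd.
Qed.

(* The second moments are invariant under orthogonal conjugation: sign changes kill
   the off-diagonal entries and transpositions equate the diagonal ones.  The exact
   value [v = 1] is not needed, since it is absorbed by the factor kappa. *)
Lemma int_mx_standard_gaussian n (W : Omega -> 'cV[R]_n) :
  measurable_fun setT W ->
  (forall A, measurable A -> P (W @^-1` A) = gauss_measure A) ->
  mx_integrable P (fun w => W w *m (W w)^T) ->
  exists v : R, int_mx P (fun w => W w *m (W w)^T) = v%:M.
Proof.
move=> mW Wlaw iW; set V := int_mx _ _.
have VU (U : 'M[R]_n) : U^T *m U = 1%:M -> V = U *m V *m U^T.
  move=> UU; rewrite -int_mxMl// -int_mxMr; last exact: mx_integrableMl.
  apply/matrixP => i j; rewrite !mxE; congr fine.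
  have mUW : measurable_fun setT (fun w => U *m W w) by exact: measurable_mulmx.
  pose f (u : 'cV[R]_n) := ((u *m u^T) i j)%:E : \bar R.
  have mf : measurable_fun setT f.
    apply/measurable_EFinP; apply: (measurableT_comp (measurable_mx_entry i j)).
    by apply: measurable_mulmx => //; exact: measurable_trmx.
  have same A : measurable A -> P (W @^-1` A) = P ((fun w => U *m W w) @^-1` A).
    move=> mA; rewrite Wlaw// -(gauss_measure_orthogonal UU mA) -Wlaw//.
    rewrite -[X in measurable X]setTI.
    by apply: (_ : measurable_fun setT (fun v : 'cV[R]_n => U *m v)) => //;
      exact: measurable_mulmx.
  rewrite ((integral_eq_law mW mUW same mf (iW i j)).2).
  by apply: eq_integral => w _; rewrite /f trmx_mul !mulmxA.
have [n0|] := posnP n.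
  by exists 0; apply/matrixP => i; have := ltn_ord i; rewrite [X in (_ < X)%N]n0.
case: n W V mW Wlaw iW VU => // n W V mW Wlaw iW VU _.
exists (V 0 0); apply/matrixP => i j; rewrite !mxE.
have [<-|ij] := eqVneq i j.
  have tt : (tperm_mx 0 i)^T *m tperm_mx 0 i = 1%:M :> 'M[R]_n.+1.
    by rewrite tr_tperm_mx -perm_mxM tperm2 perm_mx1.
  have := congr1 (fun M : 'M[R]_n.+1 => M i i) (VU _ tt).
  by rewrite /= tr_tperm_mx -xrowE -xcolE !mxE tpermR mulr1n.
pose U : 'M[R]_n.+1 := diag_mx (\row_k (if k == i then -1 else 1)).
have UT : U^T = U by rewrite tr_diag_mx.
have UU : U^T *m U = 1%:M.
  rewrite UT mul_diag_mx; apply/matrixP => k l; rewrite !mxE.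
  by have [->|kl] := eqVneq k l; case: (l == i);
    rewrite ?mulr0n ?mulr1n ?mulr0 ?mulrNN ?mulr1.
have := congr1 (fun M : 'M[R]_n.+1 => M i j) (VU U UU).
rewrite UT mul_diag_mx mul_mx_diag !mxE eqxx eq_sym (negbTE ij) mulr1 mulN1r.
by rewrite mulr0n => /eqP; rewrite -addr_eq0 -mulr2n mulrn_eq0/= => /eqP.
Qed.

End independent_residual.

Section regression.
Context {disp : measure_display} {Omega : measurableType disp} {R : realType}.
Variable P : probability Omega R.

Lemma error_covarianceE d n (x : {RV P >-> 'cV[R]_d}) (y : {RV P >-> 'cV[R]_n}) m :
  error_covariance x y m = int_mx P (outer_error x y m).
Proof. by apply/matrixP => i j; rewrite !mxE unlock. Qed.

(** Conditioning on the whole space, [B := setT], shows that the error covariance is the mean of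
    [S (x w)], and positive definiteness passes to means. *)
Lemma error_covariance_posdef d n (x : {RV P >-> 'cV[R]_d})
    (y : {RV P >-> 'cV[R]_n}) m S :
  is_cond_covariance x y m S -> {ae P, forall w, posdefmx (S (x w))} ->
  posdefmx (error_covariance x y m).
Proof.
move=> Scov Spos.
have -> : error_covariance x y m = int_mx P (S \o x).
  apply/matrixP => i j; rewrite error_covarianceE !mxE; congr fine.
  by have [_ _ _ /(_ setT measurableT)] := Scov i j; rewrite preimage_setT.
apply: int_mx_posdef => // i j.
by have [_ _ iS _] := Scov i j.
Qed.

Lemma ae_forall_ord n (Q : 'I_n -> Omega -> Prop) :
  (forall i, {ae P, forall w, Q i w}) -> {ae P, forall w, forall i, Q i w}.
Proof. by move=> QP; exact: filter_forall. Qed.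

(** The residual is [N *m Z] with the rows of [N] orthogonal to those of [A1]. If [L] is a Cholesky
    factor of [N *m N^T], the rows of [Q = invmx L *m N] are orthonormal, and [W = Q *m Z].
    Completing [Q] to an orthogonal [U] makes [W] the second block of [U *m Z] and [x] a function of
    the first. *)
Lemma gaussian_regression d n (x : {RV P >-> 'cV[R]_d})
    (y : {RV P >-> 'cV[R]_n}) (m : 'cV[R]_d -> 'cV[R]_n) (S : 'cV[R]_d -> 'M[R]_n) :
  (0 < n)%N -> jointly_gaussian x y -> is_cond_mean x y m ->
  is_cond_covariance x y m S -> {ae P, forall w, posdefmx (S (x w))} ->
  exists (L : 'M[R]_n) (W : Omega -> 'cV[R]_n) (v : R),
    [/\ volume_scaling L /\ measurable_fun setT W,
        {ae P, forall w, y w = m (x w) + L *m W w},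
        forall D, measurable D -> P [set w | D (x w, W w)] =
          (\int[P]_w gauss_measure (xsection D (x w)))%E,
        0 < v & error_covariance x y m = v *: (L *m L^T)].
Proof.
move=> n0 [k [A [b [Z [Zstd XE]]]]] mmean Scov Spos.
have Sigma_pos := error_covariance_posdef Scov Spos.
set Sigma := error_covariance x y m in Sigma_pos *.
pose A1 := usubmx A; pose A2 := dsubmx A; pose b1 := usubmx b; pose b2 := dsubmx b.
have XE2 : {ae P, forall w, x w = A1 *m Z w + b1 /\ y w = A2 *m Z w + b2}.
  apply: filterS XE => w; rewrite -[A]vsubmxK -[b]vsubmxK mul_col_mx add_col_mx.
  by move/eq_col_mx.
have xE : {ae P, forall w, x w = A1 *m Z w + b1} by apply: filterS XE2 => w [].
have yE : {ae P, forall w, y w = A2 *m Z w + b2} by apply: filterS XE2 => w [].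
have [K [N [H [A2E A1N HH A1H NH]]]] := regression_matrices A1 A2.
have mE : {ae P, forall w, m (x w) = K *m (x w - b1) + b2}.
  have : {ae P, forall w, forall i, m (x w) i 0 = (K *m (x w - b1) + b2) i 0}.
    apply: (ae_forall_ord
      (Q := fun i w => m (x w) i 0 = (K *m (x w - b1) + b2) i 0)) => i.
    have mi := mmean i; have [iy _ _ _] := mi.
    exact: (cond_expectation_unique mi
      (cond_expectation_regression Zstd xE yE A2E HH A1H NH iy)).
  by apply: filterS => w mxE'; apply/colP => i.
have rE : {ae P, forall w, y w - m (x w) = N *m Z w}.
  apply: filterS2 XE2 mE => w [-> ->] ->.
  rewrite addrK A2E mulmxDl mulmxA.
  by move: (K *m A1 *m Z w) (N *m Z w) => p q; apply/colP => i; rewrite !mxE; ring.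
have iO : mx_integrable P (outer_error x y m).
  by move=> i j; have [iO _ _ _] := Scov i j.
have mZ : measurable_fun setT Z by [].
have mNN : measurable_fun setT (fun w => (N *m Z w) *m (N *m Z w)^T).
  apply: measurable_mulmx; last apply: measurable_trmx; exact: measurable_mulmx.
have [iNN SigmaE] : mx_integrable P (fun w => (N *m Z w) *m (N *m Z w)^T) /\
    int_mx P (outer_error x y m) = int_mx P (fun w => (N *m Z w) *m (N *m Z w)^T).
  apply: eq_ae_mx_integrable => //.
  by apply: filterS rE => w; rewrite /outer_error => ->.
rewrite -error_covarianceE -/Sigma in SigmaE.
(* A vector killed by [N^T] would have zero quadratic form under the positive definite [Sigma]. *)
have N_inj (v : 'cV[R]_n) : v != 0 -> N^T *m v != 0.
  move=> v0; apply/eqP => Nv; have := Sigma_pos.2 v v0.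
  rewrite SigmaE -int_mxMl// -int_mxMr; last exact: mx_integrableMl.
  rewrite mxE integral0_eq ?ltxx// => w _.
  by rewrite mulmxA -mulmxA trmx_mul -(mulmxA _ _ v) Nv !mulmx0 mxE.
have [L [volL LL]] := posdef_cholesky (gram_posdef N_inj).
have uL := volume_scaling_unitmx volL.
pose Q := invmx L *m N.
have QQ : Q *m Q^T = 1%:M.
  rewrite /Q trmx_mul mulmxA -(mulmxA (invmx L)) -LL mulKmx// trmx_inv.
  by rewrite mulmxV// unitmx_tr.
have A1Q : A1 *m Q^T = 0 by rewrite /Q trmx_mul mulmxA A1N mul0mx.
have NE : N = L *m Q by rewrite /Q mulKVmx.
have [r [Q' [rk Q'Q' Q'Q]]] := orthonormal_completion QQ.
subst k.
pose U := col_mx Q' Q.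
have UU : U^T *m U = 1%:M.
  apply: mulmx1C; rewrite /U tr_col_mx mul_col_row Q'Q' QQ Q'Q.
  by rewrite -[Q *m Q'^T]trmxK trmx_mul trmxK Q'Q trmx0 -scalar_mx_block.
(* The rows of [A1] are orthogonal to those of [Q], so [A1 *m Z] depends on [Q' *m Z] only. *)
have A1E : A1 = A1 *m Q'^T *m Q'.
  rewrite -[LHS]mulmx1 -UU /U tr_col_mx mul_row_col mulmxDr !mulmxA A1Q.
  by rewrite !mul0mx addr0.
pose W w := dsubmx (U *m Z w).
have WE w : W w = Q *m Z w by rewrite /W /U mul_col_mx col_mxKd.
have VE w : usubmx (U *m Z w) = Q' *m Z w by rewrite /U mul_col_mx col_mxKu.
have mW : measurable_fun setT W.
  by rewrite (_ : W = fun w => Q *m Z w); [exact: measurable_mulmx|exact/funext].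
pose g v := A1 *m Q'^T *m v + b1.
have mg : measurable_fun setT g by exact: measurable_affine.
have gE : {ae P, forall w, x w = g (usubmx (U *m Z w))}.
  by apply: filterS xE => w ->; rewrite /g VE mulmxA -A1E.
have mgV : measurable_fun setT (fun w => g (usubmx (U *m Z w))).
  apply: (measurableT_comp mg); under eq_fun do rewrite VE.
  exact: measurable_mulmx.
have law D : measurable D -> P [set w | D (x w, W w)] =
    (\int[P]_w gauss_measure (xsection D (x w)))%E.
  move=> mD.
  have meas (f : Omega -> 'cV[R]_d) : measurable_fun setT f ->
      measurable [set w | D (f w, W w)].
    move=> mf; rewrite -[X in measurable X]setTI.
    by apply: (_ : measurable_fun setT (fun w => (f w, W w))) => //;
      exact: measurable_fun_pair.
  have measG (f : Omega -> 'cV[R]_d) : measurable_fun setT f ->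
      measurable_fun setT (fun w => gauss_measure (xsection D (f w))).
    by move=> mf; exact: measurableT_comp (measurable_fun_xsection _ mD) mf.
  transitivity (P [set w | D (g (usubmx (U *m Z w)), W w)]).
    apply: ae_eq_probability; [exact: meas|exact: meas|].
    by apply: filterS gE => w xw /=; rewrite xw.
  rewrite (gaussian_block_law Zstd UU mg mD).
  apply: ae_eq_integral => //; [exact: measG|exact: measG|].
  by apply: filterS gE => w xw _ /=; rewrite xw.
have Wlaw E : measurable E -> P (W @^-1` E) = gauss_measure E.
  move=> mE'; have := law (setT `*` E) (measurableX measurableT mE').
  rewrite (_ : [set w | _] = W @^-1` E); last by apply/seteqP; split=> w /=; [case|].
  move=> ->; under eq_integral do rewrite in_xsectionX ?inE//.
  by rewrite integral_cst//= probability_setT mule1.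
have iWW : mx_integrable P (fun w => W w *m (W w)^T).
  have -> : (fun w => W w *m (W w)^T) =
      (fun w => invmx L *m (N *m Z w *m (N *m Z w)^T) *m (invmx L)^T).
    by apply/funext => w; rewrite WE /Q !trmx_mul !mulmxA.
  exact/mx_integrableMr/mx_integrableMl.
have [v VWE] := int_mx_standard_gaussian mW Wlaw iWW.
have SigmaL : Sigma = v *: (L *m L^T).
  rewrite SigmaE (_ : (fun w => _) =
      (fun w => L *m (W w *m (W w)^T) *m L^T)); last first.
    by apply/funext => w; rewrite WE NE !trmx_mul !mulmxA.
  rewrite int_mxMr; last exact: mx_integrableMl.
  by rewrite int_mxMl// VWE mul_mx_scalar -scalemxAl.
exists L, W, v; split => //.
- apply: filterS rE => w; rewrite NE -mulmxA -WE => <-.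
  by rewrite addrC subrK.
(* Any nonzero vector decides the sign of [v]; one exists because [0 < n]. *)
- pose e : 'cV[R]_n := const_mx 1.
  have e0 : e != 0.
    by apply/eqP => /colP/(_ (Ordinal n0)); rewrite !mxE => /eqP; rewrite oner_eq0.
  have := Sigma_pos.2 e e0; rewrite SigmaL -scalemxAr -scalemxAl mxE.
  have s0 : 0 <= (e^T *m (L *m L^T) *m e) 0 0.
    rewrite mulmxA -mulmxA (_ : e^T *m L = (L^T *m e)^T) ?sqnorm_ge0//.
    by rewrite trmx_mul trmxK.
  by move=> ve; rewrite ltNge; apply/negP => v0; move: ve; rewrite ltNge mulr_le0_ge0.
Qed.

End regression.

(** * Optimal ellipsoids *)

Section ellipsoid_geometry.
Context {R : realType}.
Local Notation vol := (@lebesgue_volume R _).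

Lemma ellipsoid_cholesky n (C : 'M[R]_n) : posdefmx C ->
  exists T : 'M[R]_n, [/\ volume_scaling T, T *m T^T = C,
    Num.sqrt (\det C) = \det T &
    forall mu y, ellipsoid mu C y <-> sqnorm (invmx T *m (y - mu)) <= 1].
Proof.
move=> /posdef_cholesky [T [volT TT]]; have uT := volume_scaling_unitmx volT.
exists T; split => //.
  rewrite -TT det_mulmx det_tr -expr2 sqrtr_sqr gtr0_norm//.
  by case: volT.
move=> mu y; rewrite /ellipsoid/= /sqnorm trmx_mul -TT.
rewrite (_ : invmx (T *m T^T) = (invmx T)^T *m invmx T) ?mulmxA//.
have TTV : (T *m T^T) *m ((invmx T)^T *m invmx T) = 1%:M.
  by rewrite mulmxA -(mulmxA T) -trmx_mul mulVmx// trmx1 mulmx1 mulmxV.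
have uTT : T *m T^T \in unitmx by rewrite unitmx_mul unitmx_tr uT.
by rewrite -[RHS](mulKmx uTT) TTV mulmx1.
Qed.

(** Clearing the determinant makes membership a polynomial inequality in the entries, from which
    joint measurability in centre, shape and point is immediate. *)
Lemma ellipsoid_posdef_adjugate n (C : 'M[R]_n) mu y : posdefmx C ->
  ellipsoid mu C y <-> ((y - mu)^T *m \adj C *m (y - mu)) 0 0 - \det C <= 0.
Proof.
move=> pC; have [T [[T0 _] TT _ _]] := ellipsoid_cholesky pC.
have C0 : 0 < \det C by rewrite -TT det_mulmx det_tr mulr_gt0.
rewrite /ellipsoid/= /invmx (posdefmx_unitmx pC) -scalemxAr -scalemxAl mxE.
by rewrite ler_pdivrMl// mulr1 subr_le0.
Qed.

Lemma measurable_ellipsoid d (T : measurableType d) n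
    (mu y : T -> 'cV[R]_n) (C : T -> 'M[R]_n) :
  measurable_fun setT mu -> measurable_fun setT C -> measurable_fun setT y ->
  (forall t, posdefmx (C t)) -> measurable [set t | ellipsoid (mu t) (C t) (y t)].
Proof.
move=> mmu mC my pC; pose z t := y t - mu t.
rewrite (_ : [set _ | _] =
    [set t | ((z t)^T *m \adj (C t) *m z t) 0 0 - \det (C t) <= 0]); last first.
  by apply/seteqP; split=> t; rewrite /= ellipsoid_posdef_adjugate.
have mz : measurable_fun setT z by exact: measurable_submx.
apply: measurable_le_set; apply: measurable_funB; last exact: measurable_det.
apply: (measurableT_comp (measurable_mx_entry 0 0)).
apply: measurable_mulmx => //; apply: measurable_mulmx; first exact: measurable_trmx.
exact: measurable_adjugate.
Qed.

(** Serves the case [eta = 0], where every radius is feasible. The bound [s ^+ n <= s] rests on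
    [0 < n] and [s <= 1]. *)
Lemma vol_cball_small n (a : R) (r : \bar R) : (0 < n)%N -> 0 < a -> (0 < r)%E ->
  exists2 rho, 0 < rho & (a%:E * vol (cball rho : set 'cV[R]_n) < r)%E.
Proof.
move=> n0 a0; pose c := fine (vol (cball 1 : set 'cV[R]_n)).
have cE : vol (cball 1 : set 'cV[R]_n) = c%:E.
  by rewrite fineK// ge0_fin_numE// vol_cball_fin.
have c0 : 0 <= c by rewrite -lee_fin -cE.
case: r => [r| |]// r0; last first.
  by exists 1 => //; rewrite cE -EFinM ltry.
rewrite lte_fin in r0; have D0 : 0 < a * c + 1 by rewrite ltr_pwDr// mulr_ge0// ltW.
pose s := Num.min 1 (r / (a * c + 1)).
have s0 : 0 < s by rewrite lt_min ltr01 divr_gt0.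
have s1 : s <= 1 by rewrite ge_min lexx.
exists (s ^+ 2); first by rewrite exprn_gt0.
rewrite vol_cball// cE -!EFinM lte_fin.
apply: (@le_lt_trans _ _ ((a * c) * (r / (a * c + 1)))).
  rewrite mulrCA mulrC ler_wpM2l//; first by rewrite mulr_ge0// ltW.
  rewrite (@le_trans _ _ s)//; last by rewrite ge_min lexx orbT.
  by rewrite -(prednK n0) exprS ler_piMr ?(ltW s0)// exprn_ile1// ltW.
by rewrite mulrCA gtr_pMr// ltr_pdivrMr// mul1r ltrDl.
Qed.

End ellipsoid_geometry.

(** * Comparison with arbitrary candidates *)

Section optimality.
Context {disp : measure_display} {Omega : measurableType disp} {R : realType}.
Variable P : probability Omega R.
Local Notation vol := (@lebesgue_volume R _).
Variables (d n : nat) (x : {RV P >-> 'cV[R]_d}) (y : {RV P >-> 'cV[R]_n}).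
Variables (m : 'cV[R]_d -> 'cV[R]_n) (L : 'M[R]_n) (W : Omega -> 'cV[R]_n).
Hypotheses (mm : measurable_fun setT m) (volL : volume_scaling L).
Hypothesis mW : measurable_fun setT W.
Hypothesis yE : {ae P, forall w, y w = m (x w) + L *m W w}.
Hypothesis law : forall D, measurable D -> P [set w | D (x w, W w)] =
  (\int[P]_w gauss_measure (xsection D (x w)))%E.

Let mx : measurable_fun setT x. Proof. by []. Qed.
Let uL : L \in unitmx. Proof. exact: volume_scaling_unitmx. Qed.

Section fixed_ellipsoids.
Variables (mu : 'cV[R]_d -> 'cV[R]_n) (C : 'cV[R]_d -> 'M[R]_n).
Hypotheses (mmu : measurable_fun setT mu) (mC : measurable_fun setT C).
Hypothesis pC : forall u, posdefmx (C u).

(* The ellipsoid at [u] in the whitened coordinates [w] given by [y = m u + L w]. *)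
Definition whitened u : set 'cV[R]_n :=
  [set w | ellipsoid (mu u) (C u) (m u + L *m w)].

(** Presenting the whitened sets as sections of one measurable set makes their Gaussian measure and
    their volume measurable in [u]. *)
Let D : set ('cV[R]_d * 'cV[R]_n) := [set p | whitened p.1 p.2].

Let mD : measurable D.
Proof.
have m1 := @measurable_fst _ _ 'cV[R]_d 'cV[R]_n.
apply: (measurable_ellipsoid (mu := mu \o fst) (C := C \o fst)
  (y := fun p => m p.1 + L *m p.2)).
- exact: measurableT_comp.
- exact: measurableT_comp.
- apply: measurable_addmx; first exact: measurableT_comp.
  exact: measurable_mulmx.
- by move=> p; exact: pC.
Qed.

Lemma xsection_whitened u : xsection D u = whitened u.
Proof. by apply/seteqP; split=> w; rewrite /xsection/= inE. Qed.

Lemma measurable_whitened u : measurable (whitened u).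
Proof. by rewrite -xsection_whitened; exact: measurable_xsection. Qed.

Lemma measurable_gauss_whitened :
  measurable_fun setT (fun w => gauss_measure (whitened (x w))).
Proof.
under eq_fun do rewrite -xsection_whitened.
exact: measurableT_comp (measurable_fun_xsection _ mD) mx.
Qed.

Lemma measurable_vol_whitened : measurable_fun setT (fun w => vol (whitened (x w))).
Proof.
under eq_fun do rewrite -xsection_whitened.
exact: measurableT_comp (measurable_fun_xsection _ mD) mx.
Qed.

Lemma whitenedE u : exists T : 'M[R]_n, [/\ volume_scaling T, T *m T^T = C u,
  Num.sqrt (\det (C u)) = \det T & whitened u =
  [set w | sqnorm ((invmx T *m L) *m w + invmx T *m (m u - mu u)) <= 1]].
Proof.
have [T [volT TT detT TE]] := ellipsoid_cholesky (pC u); exists T; split => //.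
apply/seteqP; split=> w; rewrite /whitened/= TE -mulmxA -mulmxDr;
  by rewrite addrCA addrA.
Qed.

(** The whitened set is the preimage of the unit ball under an affine map with linear part
    [invmx T *m L], where [\det T] is the square root of [\det (C u)]. *)
Lemma vol_whitened u : ((\det L)%:E * vol (whitened u))%E = ellipsoid_volume (C u).
Proof.
have [T [volT _ detT ->]] := whitenedE u.
have [_ volM] := volume_scaling_mul (volume_scaling_inv volT) volL.
have {}volM := volM (cball 1) (invmx T *m (m u - mu u)) (measurable_cball 1).
rewrite /ellipsoid_volume /unit_ball_volume -/(cball 1) -volM detT.
rewrite [RHS]muleAC -EFinM; congr (_%:E * _)%E.
rewrite det_mulmx det_inv mulrAC mulVf ?mul1r//.
by rewrite gt_eqF//; case: volT.
Qed.

Lemma coverage_whitened :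
  P [set w | ellipsoid (mu (x w)) (C (x w)) (y w)] =
  (\int[P]_w gauss_measure (whitened (x w)))%E.
Proof.
transitivity (P [set w | D (x w, W w)]).
  apply: ae_eq_probability.
  - apply: measurable_ellipsoid => //.
    + exact: measurableT_comp.
    + exact: measurableT_comp.
  - rewrite -[X in measurable X]setTI.
    by apply: (_ : measurable_fun setT (fun w => (x w, W w))) => //;
      exact: measurable_fun_pair.
  - by apply: filterS yE => w yw; rewrite /D /whitened/= yw.
rewrite law//; apply: eq_integral => w _.
by rewrite xsection_whitened.
Qed.

Lemma objective_whitened :
  mve_objective x C = ((\det L)%:E * \int[P]_w vol (whitened (x w)))%E.
Proof.
rewrite -ge0_integralZl//.
- by apply: eq_integral => w _; rewrite vol_whitened.
- exact: measurable_vol_whitened.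
- by rewrite lee_fin ltW//; case: volL.
Qed.

Lemma objective_gt0 : (0 < mve_objective x C)%E.
Proof.
have pos w : (0 < ellipsoid_volume (C (x w)))%E.
  have [T [[T0 _] _ detT _]] := whitenedE (x w).
  by rewrite /ellipsoid_volume mule_gt0 ?lte_fin ?detT//; exact: (vol_cball_gt0 n ltr01).
apply: probability_integral_gt0; last exact: nearW.
- under eq_fun do rewrite -vol_whitened.
  exact: measurable_funeM measurable_vol_whitened.
- by move=> w; exact/ltW/pos.
Qed.

End fixed_ellipsoids.
Lemma posdefmx_concentric rho : 0 < rho -> posdefmx (rho *: (L *m L^T)).
Proof.
move=> rho0; have [LT pL] : posdefmx (L *m L^T).
  have uLT : L^T \in unitmx by rewrite unitmx_tr.
  apply: gram_posdef => v; apply: contra => /eqP Lv.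
  by rewrite -[v](mulKmx uLT) Lv mulmx0.
split; first by rewrite linearZ/= LT.
by move=> v /pL v0; rewrite -scalemxAr -scalemxAl mxE mulr_gt0.
Qed.

Lemma whitened_concentric rho u : 0 < rho ->
  whitened m (fun=> rho *: (L *m L^T)) u = cball rho.
Proof.
move=> rho0; have uC := posdefmx_unitmx (posdefmx_concentric rho0).
have invC : invmx (rho *: (L *m L^T)) = rho^-1 *: ((invmx L)^T *m invmx L).
  have CV : rho *: (L *m L^T) *m (rho^-1 *: ((invmx L)^T *m invmx L)) = 1%:M.
    rewrite -scalemxAl -scalemxAr scalerA mulfV ?gt_eqF// scale1r.
    by rewrite mulmxA -(mulmxA L) -trmx_mul mulVmx// trmx1 mulmx1 mulmxV.
  by rewrite -[RHS](mulKmx uC) CV mulmx1.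
apply/seteqP; split=> w; rewrite /whitened /ellipsoid /cball/= addrAC subrr add0r;
  rewrite invC -scalemxAr -scalemxAl mxE trmx_mul !mulmxA -(mulmxA w^T) -trmx_mul;
  by rewrite mulVmx// trmx1 mulmx1 -(mulmxA w^T) mulVmx// mulmx1 ler_pdivrMl// mulr1.
Qed.

Lemma concentric_coverage rho : 0 < rho ->
  P [set w | ellipsoid (m (x w)) (rho *: (L *m L^T)) (y w)] =
  gauss_measure (cball rho : set 'cV[R]_n).
Proof.
move=> rho0; have pC := posdefmx_concentric rho0.
rewrite (@coverage_whitened m (fun=> rho *: (L *m L^T)))//.
under eq_integral do rewrite whitened_concentric//.
by rewrite integral_cst//= probability_setT mule1.
Qed.

Lemma concentric_objective rho : 0 < rho ->
  mve_objective x (fun=> rho *: (L *m L^T)) =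
  ((\det L)%:E * vol (cball rho : set 'cV[R]_n))%E.
Proof.
move=> rho0; have pC := posdefmx_concentric rho0.
rewrite (@objective_whitened m (fun=> rho *: (L *m L^T)))//.
under eq_integral do rewrite whitened_concentric//.
by rewrite integral_cst//= probability_setT mule1.
Qed.

Section optimal_radius.
Variables (eta rho : R).
Hypotheses (rho0 : 0 < rho).
Hypothesis gaussB : gauss_measure (cball rho : set 'cV[R]_n) = eta%:E.
Let t := gauss_level n rho.
Let t0 : 0 < t. Proof. exact: gauss_level_gt0. Qed.
Let B : set 'cV[R]_n := cball rho.

Let volB_fin : vol B \is a fin_num.
Proof. by rewrite ge0_fin_numE// vol_cball_fin. Qed.

Section competitor.
Variables (mu : 'cV[R]_d -> 'cV[R]_n) (C : 'cV[R]_d -> 'M[R]_n).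
Hypothesis feas : mve_feasible x y eta mu C.

Let mmu : measurable_fun setT mu. Proof. by case: feas. Qed.
Let mC : measurable_fun setT C. Proof. by case: feas. Qed.
Let pC : forall u, posdefmx (C u). Proof. by case: feas. Qed.
Let mgE := measurable_gauss_whitened mmu mC pC.
Let mvE := measurable_vol_whitened mmu mC pC.

Let mcov : measurable [set w | ellipsoid (mu (x w)) (C (x w)) (y w)].
Proof. by apply: measurable_ellipsoid => //; exact: measurableT_comp. Qed.

Let integral_lhs :
  (\int[P]_w (gauss_measure (whitened mu C (x w)) + t%:E * vol B) =
   P [set w | ellipsoid (mu (x w)) (C (x w)) (y w)] + t%:E * vol B)%E.
Proof.
rewrite ge0_integralD//; last by move=> w _; rewrite mule_ge0// lee_fin ltW.
by rewrite -coverage_whitened// integral_cst//= probability_setT mule1.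
Qed.

Let integral_rhs :
  (\int[P]_w (gauss_measure B + t%:E * vol (whitened mu C (x w))) =
   eta%:E + t%:E * \int[P]_w vol (whitened mu C (x w)))%E.
Proof.
rewrite ge0_integralD//; last 2 first.
- by move=> w _; rewrite mule_ge0// lee_fin ltW.
- exact: measurable_funeM.
rewrite integral_cst//= probability_setT mule1; congr (_ + _)%E; first exact: gaussB.
by rewrite ge0_integralZl// lee_fin ltW.
Qed.

Let pointwise u : (gauss_measure (whitened mu C u) + t%:E * vol B <=
  gauss_measure B + t%:E * vol (whitened mu C u))%E.
Proof. by apply: neyman_pearson; exact: measurable_whitened. Qed.

(** In the integrated comparison the competitor contributes coverage at least [eta] and the ball
    exactly [eta]; then [eta] and the factor [t] cancel. *)
Lemma concentric_objective_le :
  (mve_objective x (fun=> rho *: (L *m L^T)) <= mve_objective x C)%E.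
Proof.
rewrite concentric_objective// (objective_whitened mmu mC pC).
have detL : 0 < \det L by case: volL.
rewrite lee_pmul2l//; have [_ _ _ cov] := feas.
have : (eta%:E + t%:E * vol B <=
    eta%:E + t%:E * \int[P]_w vol (whitened mu C (x w)))%E.
  apply: (@le_trans _ _
    (P [set w | ellipsoid (mu (x w)) (C (x w)) (y w)] + t%:E * vol B)%E).
    exact: leeD2r.
  rewrite -integral_lhs -integral_rhs; apply: ge0_le_integral.
  - exact: measurableT.
  - by move=> w _; rewrite adde_ge0// mule_ge0// lee_fin ltW.
  - exact: emeasurable_funD.
  - by apply: emeasurable_funD => //; exact: measurable_funeM.
  - by move=> w _; exact: pointwise.
by rewrite leeD2lE// lee_pmul2l.
Qed.

(** An objective no larger than that of the ball reverses the integrated comparison. The pointwise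
    one is then an equality for almost every value of [x], and rigidity applies there. *)
Lemma optimal_concentric :
  (mve_objective x C <= mve_objective x (fun=> rho *: (L *m L^T)))%E ->
  {ae P, forall w, mu (x w) = m (x w) /\ C (x w) = rho *: (L *m L^T)}.
Proof.
have detL : 0 < \det L by case: volL.
rewrite concentric_objective// (objective_whitened mmu mC pC) lee_pmul2l// => opt.
have [_ _ _ cov] := feas.
have : {ae P, forall w, (gauss_measure (whitened mu C (x w)) + t%:E * vol B)%E =
    (gauss_measure B + t%:E * vol (whitened mu C (x w)))%E}.
  apply: ge0_le_integral_ae_eq.
  - exact: emeasurable_funD.
  - by apply: emeasurable_funD => //; exact: measurable_funeM.
  - move=> w; rewrite fin_numD fin_numM// andbT.
    by rewrite fin_num_measure//; exact: measurable_whitened.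
  - by move=> w; rewrite adde_ge0// mule_ge0// lee_fin ltW.
  - by move=> w; exact: pointwise.
  - rewrite integral_lhs lte_add_pinfty//.
      by apply: le_lt_trans (probability_le1 _ _) _; [exact: mcov|exact: ltry].
    by rewrite ltey_eq fin_numM.
  - rewrite integral_lhs integral_rhs; apply: leeD => //.
    by rewrite lee_pmul2l.
apply: filterS => w eqw; have [T [volT TT _ wE]] := whitenedE mu pC (x w).
have uT := volume_scaling_unitmx volT.
have uM : invmx T *m L \in unitmx by rewrite unitmx_mul unitmx_inv uT.
have [|c0 MM] := @neyman_pearson_ellipsoid R n rho _
  (invmx T *m (m (x w) - mu (x w))) rho0 uM.
  by rewrite -wE -eqw.
have mE : m (x w) - mu (x w) = 0 by rewrite -[LHS](mulKVmx uT) c0 mulmx0.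
split; first by apply/esym/eqP; rewrite -subr_eq0 mE.
(* Since [M] is a multiple of an orthogonal matrix, [rho *: (M *m M^T)] is the identity; with
   [L = T *m M] this turns [rho *: (L *m L^T)] into [T *m T^T], which is the given shape. *)
set M := invmx T *m L in MM *.
have MMr : M *m (rho *: M^T) = 1%:M.
  apply: mulmx1C; rewrite -scalemxAl MM -mul_scalar_mx -scalar_mxM.
  by rewrite mulfV ?gt_eqF.
have LE : L = T *m M by rewrite /M mulKVmx.
rewrite -scalemxAr in MMr.
have -> : L *m L^T = T *m (M *m M^T) *m T^T by rewrite LE trmx_mul !mulmxA.
by rewrite scalemxAl scalemxAr MMr mulmx1.
Qed.

End competitor.
End optimal_radius.

End optimality.

(** Since the infimum is not attained for [eta = 0] in positive dimension, optimality is split: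
    domination by the stated form for every [eta], attainment for [0 < eta], and the form of any
    optimum. The last can only hold almost everywhere, as the problem sees [mu] and [C] only along
    [x]. *)
Theorem theorem1 (disp : measure_display) (Omega : measurableType disp)
    (R : realType) (P : probability Omega R) (d n : nat)
    (x : {RV P >-> 'cV[R]_d}) (y : {RV P >-> 'cV[R]_n}) (eta : R)
    (m : 'cV[R]_d -> 'cV[R]_n) (S : 'cV[R]_d -> 'M[R]_n)
    (eta_ge0 : 0 <= eta) (eta_lt1 : eta < 1)
    (gaussian_xy : jointly_gaussian x y)
    (m_cond_mean : is_cond_mean x y m)
    (S_cond_cov : is_cond_covariance x y m S)
    (S_posdef : {ae P, forall w, posdefmx (S (x w))}) :
  let Sigma := error_covariance x y m in
  [/\ forall (mu : 'cV[R]_d -> 'cV[R]_n) (C : 'cV[R]_d -> 'M[R]_n),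
        mve_feasible x y eta mu C ->
        exists kappa : 'cV[R]_d -> R,
          [/\ measurable_fun setT kappa,
              forall u, 0 < kappa u,
              mve_feasible x y eta m (fun u => kappa u *: Sigma)
            & (mve_objective x (fun u => kappa u *: Sigma)
               <= mve_objective x C)%E],
      0 < eta ->
        exists kappa : 'cV[R]_d -> R,
          [/\ measurable_fun setT kappa,
              forall u, 0 < kappa u
            & mve_optimal x y eta m (fun u => kappa u *: Sigma)]
    & forall (mu : 'cV[R]_d -> 'cV[R]_n) (C : 'cV[R]_d -> 'M[R]_n),
        mve_optimal x y eta mu C ->
        exists kappa : 'cV[R]_d -> R,
          [/\ measurable_fun setT kappa,
              forall u, 0 < kappa u,
              mve_feasible x y eta m (fun u => kappa u *: Sigma)
            & {ae P, forall w, mu (x w) = m (x w) /\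
                               C (x w) = kappa (x w) *: Sigma}]].
Proof.
move=> Sigma.
have mm : measurable_fun setT m.
  by apply/measurable_mxP => i j; rewrite (ord1 j); have [] := m_cond_mean i.
(* In dimension 0 all centres and all shapes coincide and every ellipsoid is the whole space, so the
   constant [kappa = 1] serves. *)
have [n0|n0] := posnP n.
  subst n.
  have eq0 p (A B : 'M[R]_(0, p)) : A = B by rewrite (flatmx0 A) (flatmx0 B).
  have eq_shape (C C' : 'cV[R]_d -> 'M[R]_0) : C = C' by apply/funext => u; exact: eq0.
  have feas mu (C : 'cV[R]_d -> 'M[R]_0) : measurable_fun setT mu ->
      mve_feasible x y eta mu C.
    move=> mmu; split => //.
    - by rewrite (eq_shape C (fun=> 0)).
    - by move=> u; split=> [|v /eqP []]; exact: eq0.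
    - rewrite (_ : [set _ | _] = setT) ?probability_setT ?lee_fin ?ltW//.
      apply/seteqP; split=> // w _; rewrite /ellipsoid/=.
      by rewrite (eq0 _ (_ - _) 0) mulmx0 mxE ler01.
  have opt C : mve_optimal x y eta m C.
    by split=> [|mu' C' _]; [exact: feas|rewrite (eq_shape C C')].
  split=> [mu C _|eta0|mu C _]; exists (fun=> 1).
  - by split=> //; [exact: feas|rewrite (eq_shape C (fun=> 1 *: Sigma))].
  - by split.
  - split=> //; first exact: feas.
    by apply: nearW => w; split; exact: eq0.
have [L [W [v [[volL mW] yE law v0 SigmaE]]]] :=
  gaussian_regression n0 gaussian_xy m_cond_mean S_cond_cov S_posdef.
(* As [Sigma] is [v *: (L *m L^T)], the whitened ball of squared radius [rho] corresponds to
   [kappa = rho / v]. *)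
have scaleE rho : (fun u : 'cV[R]_d => (rho / v) *: Sigma) =
    (fun=> rho *: (L *m L^T)).
  by apply/funext => u; rewrite /Sigma SigmaE scalerA divfK// gt_eqF.
have ball_feasible rho : 0 < rho ->
    (eta%:E <= gauss_measure (cball rho : set 'cV[R]_n))%E ->
    mve_feasible x y eta m (fun u => (rho / v) *: Sigma).
  move=> rho0 cov; rewrite scaleE; split => //.
  - by move=> u; exact: posdefmx_concentric.
  - by rewrite (concentric_coverage mm volL mW yE law).
have detL : 0 < \det L by case: volL.
have [eta0|eta0] := ltP 0 eta.
  have [rho rho0 gaussB] := cball_quantile n0 eta0 eta_lt1.
  have rv0 : 0 < rho / v by rewrite divr_gt0.
  have Bfeas : mve_feasible x y eta m (fun u => (rho / v) *: Sigma).
    by apply: ball_feasible => //; rewrite gaussB.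
  have opt : mve_optimal x y eta m (fun u => (rho / v) *: Sigma).
    split=> // mu C feas; rewrite scaleE.
    exact: (concentric_objective_le mm volL mW yE law rho0 gaussB feas).
  split=> [mu C feas|_|mu C [feas Copt]]; exists (fun=> rho / v); split => //.
  - exact: opt.2 feas.
  - have := optimal_concentric mm volL mW yE law rho0 gaussB feas.
    rewrite -scaleE => /(_ (Copt _ _ Bfeas)); apply: filterS => w.
    by rewrite /Sigma SigmaE scalerA divfK// gt_eqF.
(* Only [eta = 0] remains. Every feasible candidate is strictly improved by a small enough ball,
   which contradicts optimality in the last clause. *)
have small mu C : mve_feasible x y eta mu C -> exists2 rho, 0 < rho &
    mve_feasible x y eta m (fun u => (rho / v) *: Sigma) /\
    (mve_objective x (fun u => (rho / v) *: Sigma) < mve_objective x C)%E.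
  move=> [mmu mC pC _].
  have obj0 := objective_gt0 x mm volL mmu mC pC.
  have [rho rho0 lt_obj] := vol_cball_small n0 detL obj0.
  exists rho => //; split.
    apply: ball_feasible => //; apply: le_trans (measure_ge0 _ _).
    by rewrite lee_fin.
  by rewrite scaleE (concentric_objective x mm volL).
split=> [mu C feas|//|mu C [feas Copt]].
- have [rho rho0 [Bfeas /ltW obj]] := small _ _ feas.
  by exists (fun=> rho / v); split => //; move=> u; rewrite divr_gt0.
- have [rho rho0 [Bfeas]] := small _ _ feas.
  by rewrite ltNge (Copt _ _ Bfeas).
Qed.
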